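(* Let $\Gamma=(V,E)$ be a finite simplicial graph, let $G_v$ be a group for each $v\in V$, and let $G=G(\Gamma;G_v,v\in V)$ be the associated graph product. Suppose that each vertex group $G_v$ $(v \in V)$ satisfies the rapid decay property (RD). Then $G$ satisfies RD.
   Context: Graph product: for a finite simplicial graph $\Gamma=(V,E)$ (undirected, no loops or multiple edges) with a group $G_v$ attached to each vertex $v$, the graph product $G(\Gamma;G_v,v\in V)$ is the quotient of the free product of the groups $G_v$ by the normal closure of all commutators $[g,g']$ with $g\in G_v$, $g'\in G_w$ and $\{v,w\}\in E$. Length function: a function $\ell:G\to\mathbb{R}$ on a group $G$ with $\ell(1_G)=0$, $\ell(g^{-1})=\ell(g)$ and $\ell(gh)\le \ell(g)+\ell(h)$ for all $g,h\in G$. The group algebra $\mathbb{C}G$ is regarded as the set of finitely supported functions $G\to\mathbb{C}$. For $\phi,\psi\in\mathbb{C}G$ put $\phi*\psi(g)=\sum_{h\in G}\phi(h)\psi(h^{-1}g)$, $\|\psi\|_2=\sqrt{\sum_{g\in G}|\psi(g)|^2}$, and, for a length function $\ell$ and a constant $r$, $\|\phi\|_{2,r,\ell}=\sqrt{\sum_{g\in G}|\phi(g)|^2(1+\ell(g))^{2r}}$. Rapid decay property: a group $G$ satisfies RD if there exist real constants $C,r$ and a length function $\ell$ on $G$ such that for all $\phi\in\mathbb{C}G$, $$\sup_{\psi\in\mathbb{C}G,\ \psi\neq 0}\frac{\|\phi*\psi\|_2}{\|\psi\|_2}\le C\,\|\phi\|_{2,r,\ell}.$$ *)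

(* Defs.v *)
From HB Require Import structures.
From mathcomp Require Import all_boot all_order all_algebra.
From mathcomp Require Import complex.
From mathcomp Require Import all_classical all_reals all_analysis.

Set Implicit Arguments.
Unset Strict Implicit.
Unset Printing Implicit Defensive.

Import Order.TTheory GRing.Theory Num.Theory.
Local Open Scope quotient_scope.
Local Open Scope classical_set_scope.
Local Open Scope group_scope.

(* The library's [groupType] carries a choice structure; as choice is available
   classically for every type ([gen_choiceMixin]), this is no restriction. *)

Section FreeProduct.
Variables (V : finType) (G : V -> groupType).

Definition fp_word := seq {v : V & G v}.

Definition letter v (a : G v) : {v : V & G v} := Tagged (fun v => G v) a.

(* The free product is the monoid of words over the disjoint union of the
   groups, modulo the congruence that deletes trivial letters and multiplies
   adjacent letters from the same group. *)
Inductive fp_rel : fp_word -> fp_word -> Prop :=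
| fp_refl s : fp_rel s s
| fp_sym s t : fp_rel s t -> fp_rel t s
| fp_trans s t u : fp_rel s t -> fp_rel t u -> fp_rel s u
| fp_one v s t : fp_rel (s ++ letter (1 : G v) :: t) (s ++ t)
| fp_mul v (a b : G v) s t :
    fp_rel (s ++ letter a :: letter b :: t) (s ++ letter (a * b) :: t).

Definition fp_relb : rel fp_word := fun s t => `[< fp_rel s t >].

Lemma fp_relb_refl : reflexive fp_relb.
Proof. by move=> s; apply/asboolP; apply: fp_refl. Qed.

Lemma fp_relb_sym : symmetric fp_relb.
Proof. by move=> s t; apply/asboolP/asboolP => h; apply: fp_sym. Qed.

Lemma fp_relb_trans : transitive fp_relb.
Proof.
by move=> t s u /asboolP st /asboolP tu; apply/asboolP; apply: fp_trans tu.
Qed.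

Canonical fp_equiv := EquivRel fp_relb fp_relb_refl fp_relb_sym fp_relb_trans.

Definition free_product := {eq_quot fp_relb}.
HB.instance Definition _ := Choice.on free_product.
HB.instance Definition _ := EqQuotient.on free_product.

Lemma fp_eqP s t : reflect (fp_rel s t) (s == t %[mod free_product]).
Proof. by rewrite eqmodE; apply: asboolP. Qed.

Lemma fp_rel_ctx p q s t : fp_rel s t -> fp_rel (p ++ s ++ q) (p ++ t ++ q).
Proof.
elim=> {s t} [s|s t _ h|s t u _ h _ h'|v s t|v a b s t].
- exact: fp_refl.
- exact: fp_sym.
- exact: fp_trans h h'.
- by rewrite -!catA /= [p ++ s ++ _]catA [p ++ s ++ t ++ q]catA; apply: fp_one.
- by rewrite -!catA /= !(catA p); apply: fp_mul.
Qed.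

Lemma fp_rel_cat s s' t t' :
  fp_rel s s' -> fp_rel t t' -> fp_rel (s ++ t) (s' ++ t').
Proof.
move=> hs ht; apply: (@fp_trans _ (s' ++ t)).
  exact: (fp_rel_ctx [::] t hs).
by have := fp_rel_ctx s' [::] ht; rewrite !cats0.
Qed.

Definition invl (x : {v : V & G v}) : {v : V & G v} :=
  letter ((tagged x : G (tag x))^-1).

Definition invw (s : fp_word) : fp_word := rev (map invl s).

Lemma invw_cat s t : invw (s ++ t) = invw t ++ invw s.
Proof. by rewrite /invw map_cat rev_cat. Qed.

Lemma invw_cons x s : invw (x :: s) = invw s ++ [:: invl x].
Proof. by rewrite /invw /= rev_cons cats1. Qed.

Lemma fp_rel_inv s t : fp_rel s t -> fp_rel (invw s) (invw t).
Proof.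
elim=> {s t} [s|s t _ h|s t u _ h _ h'|v s t|v a b s t].
- exact: fp_refl.
- exact: fp_sym.
- exact: fp_trans h h'.
- by rewrite !invw_cat invw_cons /invl /= invg1 -catA; apply: fp_one.
- rewrite !invw_cat !invw_cons /invl /= -!catA /= invgM; exact: fp_mul.
Qed.

Lemma fp_rel_mulVw s : fp_rel (invw s ++ s) [::].
Proof.
elim: s => [|[v a] s ih]; first exact: fp_refl.
rewrite invw_cons /invl -catA /=; apply: fp_trans ih.
by apply: fp_trans (fp_mul _ _ _ _) _; rewrite mulVg; apply: fp_one.
Qed.

Lemma invwK : involutive invw.
Proof.
move=> s; rewrite /invw map_rev revK -map_comp -[RHS]map_id.
by apply: eq_map => -[v a]; rewrite /invl /= invgK.
Qed.

Lemma fp_rel_mulwV s : fp_rel (s ++ invw s) [::].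
Proof. by rewrite -{1}(invwK s); apply: fp_rel_mulVw. Qed.

Definition fp_unit : free_product := \pi_free_product [::].
Definition fp_prod (x y : free_product) : free_product :=
  \pi_free_product (repr x ++ repr y).
Definition fp_inv (x : free_product) : free_product :=
  \pi_free_product (invw (repr x)).

Lemma fp_piE (x : free_product) : exists s, x = \pi_free_product s.
Proof. by exists (repr x); rewrite reprK. Qed.

Lemma fp_repr s : fp_rel (repr (\pi_free_product s)) s.
Proof. by apply/fp_eqP; rewrite reprK. Qed.

Lemma fp_prod_pi s t :
  fp_prod (\pi_free_product s) (\pi_free_product t) = \pi_free_product (s ++ t).
Proof. by apply/eqP/fp_eqP/fp_rel_cat; apply: fp_repr. Qed.

Lemma fp_inv_pi s : fp_inv (\pi_free_product s) = \pi_free_product (invw s).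
Proof. by apply/eqP/fp_eqP/fp_rel_inv/fp_repr. Qed.

Lemma fp_prodA : associative fp_prod.
Proof.
move=> x y z; have [s ->] := fp_piE x; have [t ->] := fp_piE y;
by have [u ->] := fp_piE z; rewrite !fp_prod_pi catA.
Qed.

Lemma fp_prod1g : left_id fp_unit fp_prod.
Proof. by move=> x; have [s ->] := fp_piE x; rewrite fp_prod_pi. Qed.

Lemma fp_prodg1 : right_id fp_unit fp_prod.
Proof. by move=> x; have [s ->] := fp_piE x; rewrite fp_prod_pi cats0. Qed.

Lemma fp_prodVg : left_inverse fp_unit fp_inv fp_prod.
Proof.
move=> x; have [s ->] := fp_piE x; rewrite fp_inv_pi fp_prod_pi.
by apply/eqP/fp_eqP/fp_rel_mulVw.
Qed.

Lemma fp_prodgV : right_inverse fp_unit fp_inv fp_prod.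
Proof.
move=> x; have [s ->] := fp_piE x; rewrite fp_inv_pi fp_prod_pi.
by apply/eqP/fp_eqP/fp_rel_mulwV.
Qed.

HB.instance Definition _ := isGroup.Build free_product
  fp_prodA fp_prod1g fp_prodg1 fp_prodVg fp_prodgV.

Definition fp_in v (a : G v) : free_product := \pi_free_product [:: letter a].

End FreeProduct.

Section NormalClosureQuotient.
Variable (F : groupType).

Record normal_subgroup (N : set F) : Prop := NormalSubgroup {
  normal1 : N 1;
  normalM : forall x y, N x -> N y -> N (x * y);
  normalV : forall x, N x -> N x^-1;
  normalJ : forall x y, N x -> N (x ^ y) }.

Definition normal_closure (S : set F) : set F := smallest normal_subgroup S.

Lemma normal_closureP (S : set F) : normal_subgroup (normal_closure S).
Proof.
split=> [N [[? ? ? ?] _]|x y hx hy N hN|x hx N hN|x y hx N hN] //.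
- by case: (hN) => -[_ h _ _] _; apply: h; [apply: hx|apply: hy].
- by case: (hN) => -[_ _ h _] _; apply: h; apply: hx.
- by case: (hN) => -[_ _ _ h] _; apply: h; apply: hx.
Qed.

Variable (S : set F).
Local Notation N := (normal_closure S).

Definition ncl_relb : rel F := fun x y => `[< N (x^-1 * y) >].

Lemma ncl_relb_refl : reflexive ncl_relb.
Proof.
by move=> x; apply/asboolP; rewrite mulVg; apply: normal1 (normal_closureP S).
Qed.

Lemma ncl_relb_sym : symmetric ncl_relb.
Proof.
by move=> x y; apply/asboolP/asboolP => /(normalV (normal_closureP S));
  rewrite invgM invgK.
Qed.

Lemma ncl_relb_trans : transitive ncl_relb.
Proof.
move=> y x z /asboolP xy /asboolP yz; apply/asboolP.
by have := normalM (normal_closureP S) xy yz; rewrite mulgA mulgK.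
Qed.

Canonical ncl_equiv :=
  EquivRel ncl_relb ncl_relb_refl ncl_relb_sym ncl_relb_trans.

Definition ncl_quotient := {eq_quot ncl_relb}.
HB.instance Definition _ := Choice.on ncl_quotient.
HB.instance Definition _ := EqQuotient.on ncl_quotient.

Lemma ncl_eqP x y : reflect (N (x^-1 * y)) (x == y %[mod ncl_quotient]).
Proof. by rewrite eqmodE; apply: asboolP. Qed.

Definition ncl_unit : ncl_quotient := \pi_ncl_quotient 1.
Definition ncl_prod (x y : ncl_quotient) : ncl_quotient :=
  \pi_ncl_quotient (repr x * repr y).
Definition ncl_inv (x : ncl_quotient) : ncl_quotient :=
  \pi_ncl_quotient (repr x)^-1.

Lemma ncl_piE (x : ncl_quotient) : exists y, x = \pi_ncl_quotient y.
Proof. by exists (repr x); rewrite reprK. Qed.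

Lemma ncl_repr x : N ((repr (\pi_ncl_quotient x))^-1 * x).
Proof. by apply/ncl_eqP; rewrite reprK. Qed.

Lemma ncl_prod_pi x y :
  ncl_prod (\pi_ncl_quotient x) (\pi_ncl_quotient y) = \pi_ncl_quotient (x * y).
Proof.
apply/eqP/ncl_eqP; have hN := normal_closureP S.
set x' := repr _; set y' := repr _.
have -> : (x' * y')^-1 * (x * y) = (x'^-1 * x) ^ y' * (y'^-1 * y).
  by rewrite conjgE invgM !mulgA mulgK.
by apply: (normalM hN); [apply: (normalJ hN)|]; apply: ncl_repr.
Qed.

Lemma ncl_inv_pi x : ncl_inv (\pi_ncl_quotient x) = \pi_ncl_quotient x^-1.
Proof.
apply/eqP/ncl_eqP; have hN := normal_closureP S.
set x' := repr _; rewrite invgK.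
have -> : x' * x^-1 = ((x'^-1 * x)^-1) ^ x^-1.
  by rewrite conjgE invgM !invgK mulgA mulVKg.
by apply: (normalJ hN); apply: (normalV hN); apply: ncl_repr.
Qed.

Lemma ncl_prodA : associative ncl_prod.
Proof.
move=> x y z; have [s ->] := ncl_piE x; have [t ->] := ncl_piE y;
by have [u ->] := ncl_piE z; rewrite !ncl_prod_pi mulgA.
Qed.

Lemma ncl_prod1g : left_id ncl_unit ncl_prod.
Proof. by move=> x; have [s ->] := ncl_piE x; rewrite ncl_prod_pi mul1g. Qed.

Lemma ncl_prodg1 : right_id ncl_unit ncl_prod.
Proof. by move=> x; have [s ->] := ncl_piE x; rewrite ncl_prod_pi mulg1. Qed.

Lemma ncl_prodVg : left_inverse ncl_unit ncl_inv ncl_prod.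
Proof. by move=> x; have [s ->] := ncl_piE x; rewrite ncl_inv_pi ncl_prod_pi mulVg. Qed.

Lemma ncl_prodgV : right_inverse ncl_unit ncl_inv ncl_prod.
Proof. by move=> x; have [s ->] := ncl_piE x; rewrite ncl_inv_pi ncl_prod_pi mulgV. Qed.

HB.instance Definition _ := isGroup.Build ncl_quotient
  ncl_prodA ncl_prod1g ncl_prodg1 ncl_prodVg ncl_prodgV.

End NormalClosureQuotient.

Section GraphProduct.
Variables (V : finType) (E : rel V) (G : V -> groupType).

Definition edge_commutators : set (free_product G) :=
  [set x | exists v w (g : G v) (h : G w), E v w /\ x = [~ fp_in g, fp_in h]].

Definition graph_product : groupType := ncl_quotient edge_commutators.

End GraphProduct.

Local Close Scope group_scope.
Local Open Scope ring_scope.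

Section RapidDecay.
Variables (R : realType) (G : groupType).

Record length_function (l : G -> R) : Prop := LengthFunction {
  length1 : l 1%g = 0;
  lengthV : forall g, l g^-1%g = l g;
  lengthM : forall g h, l (g * h)%g <= l g + l h }.

Definition group_algebra : set (G -> R[i]) :=
  [set phi | finite_set [set g | phi g != 0]].

(* The sums below are finitely supported sums ([fsbigop]): they have their
   intended value for functions in [group_algebra]. *)

Definition convolution (phi psi : G -> R[i]) (g : G) : R[i] :=
  \sum_(h \in [set: G]) phi h * psi (h^-1 * g)%g.

Definition norm2 (psi : G -> R[i]) : R :=
  Num.sqrt (\sum_(g \in [set: G]) Normc.normc (psi g) ^+ 2).

Definition norm2w (r : R) (l : G -> R) (phi : G -> R[i]) : R :=
  Num.sqrt (\sum_(g \in [set: G])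
    Normc.normc (phi g) ^+ 2 * (1 + l g) `^ (2 * r)).

(* The supremum is taken in the extended reals, so that an upper bound on it by
   a real number also asserts its finiteness. *)
Definition convolution_norm (phi : G -> R[i]) : \bar R :=
  ereal_sup [set (norm2 (convolution phi psi) / norm2 psi)%:E
            | psi in [set psi | group_algebra psi /\ psi <> (fun=> 0)]].

Definition rapid_decay : Prop :=
  exists (C r : R) (l : G -> R), length_function l /\
    forall phi, group_algebra phi ->
      (convolution_norm phi <= (C * norm2w r l phi)%:E)%E.

End RapidDecay.

(* Main.v *)
Require Import Defs.
From mathcomp Require Import all_boot all_order all_algebra.
From mathcomp Require Import complex ring lra.
From mathcomp Require Import all_classical all_reals all_analysis.

Set Implicit Arguments.
Unset Strict Implicit.
Unset Printing Implicit Defensive.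

Import Order.TTheory GRing.Theory Num.Theory.

(* An element of the graph product is a reduced word in the vertex groups, unique
   up to shuffling commuting letters.  For [g] and [h] one can write g = a s c and
   h = c^-1 t b, where [s] and [t] are products of pairwise commuting letters and
   a (s t) b is reduced, so that no cancellation is left.  For fixed [a], [b], [c],
   the sum of phi(a s c) psi(c^-1 t b) chi(a s t b) over [s] and [t] is controlled
   by property RD for a direct product of vertex groups, and the remaining sum over
   [a], [b], [c] by the Cauchy-Schwarz inequality.  The loss is the number of
   factorisations x = a s b of a given element into reduced parts; a prefix [a] of
   [x] is determined by its number of letters of each type, so this number is
   polynomial in the length of [a]. *)

Local Open Scope ring_scope.

(** * Trilinear form of property RD *)

(** The difficulty is that property RD lets only phi carry a weight, whereas the multiplicity of
    factorisations also affects psi and chi. It can be shifted to phi because the prefixes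
    concerned, c^-1 of h and a of gh, are both read off from g = a s c and so are no longer than g.
    Merging syllables have to be kept apart from the cancellation: an element of an infinite vertex
    group is a product of two others in infinitely many ways, so no count controls them, and this is
    where the hypothesis on the vertex groups enters. Non-negativity lets one factorisation be
    chosen for each pair (g, h) and the sum then be enlarged to independent a, b, c, s, t. Extension
    by zero also lets the direct product run over all vertices at once instead of over one clique at
    a time. *)

Section FiniteSums.
Variable R : realType.

Lemma sum_sub_uniq (T : eqType) (s r : seq T) (f : T -> R) :
  uniq s -> uniq r -> {subset s <= r} ->
  \sum_(x <- s) f x = \sum_(x <- r | x \in s) f x.
Proof.
move=> us ur sr; rewrite -[RHS]big_filter; apply: perm_big.
apply: uniq_perm; rewrite ?filter_uniq // => x; rewrite mem_filter.
by case: (boolP (x \in s)) => //= /sr ->.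
Qed.

Lemma ler_sum_sub (T : eqType) (s r : seq T) (f : T -> R) :
  uniq s -> uniq r -> {subset s <= r} -> (forall x, 0 <= f x) ->
  \sum_(x <- s) f x <= \sum_(x <- r) f x.
Proof.
move=> us ur sr f0; rewrite (sum_sub_uniq _ us ur sr).
rewrite [leRHS](bigID (fun x => x \in s)) /= lerDl.
by apply: sumr_ge0.
Qed.

Lemma cauchy_schwarz (T : Type) (s : seq T) (f g : T -> R) :
  \sum_(x <- s) f x * g x <=
  Num.sqrt (\sum_(x <- s) f x ^+ 2) * Num.sqrt (\sum_(x <- s) g x ^+ 2).
Proof.
elim: s => [|x s ih]; first by rewrite !big_nil sqrtr0 mulr0.
rewrite !big_cons; apply: le_trans (lerD (lexx _) ih) _.
have A0 : 0 <= \sum_(j <- s) f j ^+ 2 by apply: sumr_ge0 => y _; apply: sqr_ge0.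
have B0 : 0 <= \sum_(j <- s) g j ^+ 2 by apply: sumr_ge0 => y _; apply: sqr_ge0.
set a := Num.sqrt (\sum_(j <- s) f j ^+ 2); set b := Num.sqrt (\sum_(j <- s) g j ^+ 2).
rewrite -(sqr_sqrtr A0) -(sqr_sqrtr B0) -/a -/b.
move: (f x) (g x) a b => {A0 B0 ih} u v a b.
rewrite -sqrtrM ?addr_ge0 ?sqr_ge0 //.
apply: le_trans (ler_norm _) _; rewrite -sqrtr_sqr ler_sqrt; last first.
  by rewrite mulr_ge0 ?addr_ge0 ?sqr_ge0.
rewrite -subr_ge0.
have -> : (u ^+ 2 + a ^+ 2) * (v ^+ 2 + b ^+ 2) - (u * v + a * b) ^+ 2 =
  (u * b - a * v) ^+ 2 by ring.
exact: sqr_ge0.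
Qed.

(** Cauchy-Schwarz is used twice: in [c] for fixed [a] and [b], where [h0] allows multiplying by
    [h a b], then in the pair (a, b), where the square sum of [F a * H b] factors. *)
Lemma sum_triple_le (A B C : Type) (sa : seq A) (sb : seq B) (sc : seq C)
    (f : A -> C -> R) (g : C -> B -> R) (h : A -> B -> R) :
  (forall a b, 0 <= h a b) ->
  \sum_(a <- sa) \sum_(c <- sc) \sum_(b <- sb) f a c * g c b * h a b <=
  Num.sqrt (\sum_(a <- sa) \sum_(c <- sc) f a c ^+ 2) *
  Num.sqrt (\sum_(c <- sc) \sum_(b <- sb) g c b ^+ 2) *
  Num.sqrt (\sum_(a <- sa) \sum_(b <- sb) h a b ^+ 2).
Proof.
move=> h0.
pose F a := Num.sqrt (\sum_(c <- sc) f a c ^+ 2).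
pose H b := Num.sqrt (\sum_(c <- sc) g c b ^+ 2).
have s0 (T : Type) (s : seq T) (k : T -> R) : 0 <= \sum_(x <- s) k x ^+ 2.
  by apply: sumr_ge0 => x _; apply: sqr_ge0.
have -> : \sum_(a <- sa) \sum_(c <- sc) f a c ^+ 2 = \sum_(a <- sa) F a ^+ 2.
  by apply: eq_bigr => a _; rewrite sqr_sqrtr.
have -> : \sum_(c <- sc) \sum_(b <- sb) g c b ^+ 2 = \sum_(b <- sb) H b ^+ 2.
  by rewrite exchange_big; apply: eq_bigr => b _; rewrite sqr_sqrtr.
have e (k : A -> B -> R) : \sum_(a <- sa) \sum_(b <- sb) k a b =
    \sum_(x <- [seq (a, b) | a <- sa, b <- sb]) k x.1 x.2.
  by rewrite big_allpairs.
rewrite -sqrtrM // [X in Num.sqrt X * _](_ : _ =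
    \sum_(a <- sa) \sum_(b <- sb) (F a * H b) ^+ 2); last first.
  rewrite mulr_suml; apply: eq_bigr => a _; rewrite mulr_sumr.
  by apply: eq_bigr => b _; rewrite exprMn.
rewrite [X in Num.sqrt X * _]e [X in _ * Num.sqrt X]e.
apply: le_trans (cauchy_schwarz _ _ _); rewrite big_allpairs /=.
apply: ler_sum => a _; rewrite exchange_big; apply: ler_sum => b _.
by rewrite -mulr_suml ler_wpM2r // cauchy_schwarz.
Qed.

Lemma sum_uniq_le (I : finType) (s : seq I) (f : I -> R) : uniq s ->
  (forall i, 0 <= f i) -> \sum_(i <- s) f i <= \sum_i f i.
Proof.
move=> us f0; rewrite big_uniq //= [leRHS](bigID (mem s)) /= lerDl.
by apply: sumr_ge0.
Qed.

Lemma sum_inv_sq (N : nat) : \sum_(j < N) (1 + j%:R : R)^-1 ^+ 2 <= 2.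
Proof.
(* The sharper bound telescopes: 1/(a+1)^2 is at most 1/a - 1/(a+1). *)
suff h n : \sum_(j < n.+1) (1 + j%:R : R)^-1 ^+ 2 <= 2 - (1 + n%:R)^-1.
  case: N => [|n]; first by rewrite big_ord0.
  by apply: le_trans (h n) _; rewrite lerBlDr lerDl invr_ge0 addr_ge0.
elim: n => [|n ih]; first by rewrite big_ord_recr big_ord0 /= addr0 invr1; lra.
rewrite big_ord_recr /=; apply: le_trans (lerD ih (lexx _)) _.
rewrite -(natr1 n) [1 + (_ + 1)]addrA; set a : R := 1 + n%:R.
have a0 : 0 < a by rewrite /a ltr_pwDl.
have a1 : 0 < a + 1 by rewrite addr_gt0.
have -> : a^-1 = (a + 1)^-1 + a^-1 * (a + 1)^-1.
  by field; rewrite !gt_eqF.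
have : (a + 1)^-1 ^+ 2 <= a^-1 * (a + 1)^-1.
  by rewrite expr2 ler_wpM2r ?invr_ge0 ?(ltW a1) // lef_pV2 ?posrE // lerDl.
by lra.
Qed.

(* Testing [phi * psi] against [chi] turns the operator norm bound of property RD
   into a bound on a trilinear form with non-negative arguments. *)
Definition trilinear_bound (T : eqType) (mul : T -> T -> T) (w : T -> R) (C : R) :=
  forall (s t u : seq T) (phi psi chi : T -> R),
    uniq s -> uniq t -> uniq u ->
    (forall x, 0 <= phi x) -> (forall x, 0 <= psi x) -> (forall x, 0 <= chi x) ->
    (forall x y, x \in s -> y \in t -> mul x y \in u) ->
    \sum_(x <- s) \sum_(y <- t) phi x * psi y * chi (mul x y) <=
    C * (Num.sqrt (\sum_(x <- s) phi x ^+ 2 * w x) *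
         Num.sqrt (\sum_(x <- t) psi x ^+ 2) *
         Num.sqrt (\sum_(x <- u) chi x ^+ 2)).

Lemma trilinear_unit : trilinear_bound (fun _ _ => tt) (fun=> 1) 1.
Proof.
move=> s t u phi psi chi us ut uu phi0 psi0 chi0 h; rewrite mul1r.
have sE (r : seq unit) : uniq r -> r = [::] \/ r = [:: tt].
  case: r => [|[] [|[] r]] //=; [by left|by right].
have [->|es] := sE s us; first by rewrite !big_nil !mulr_ge0 ?sqrtr_ge0.
have [->|et] := sE t ut.
  by rewrite big1 ?mulr_ge0 ?sqrtr_ge0 // => x _; rewrite big_nil.
have [eu|->] := sE u uu.
  by have := h tt tt; rewrite es et eu => /(_ isT isT).
by rewrite es et !big_seq1 mulr1 !sqrtr_sqr !ger0_norm.
Qed.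

(** With the second coordinates fixed, the first bound applies to slices. The slice norms [A], [B],
    [D] are again non-negative functions, now of the second coordinate, and the second bound applies
    to them. *)
Lemma trilinear_prod (T1 T2 : eqType) mul1 mul2 (w1 : T1 -> R) (w2 : T2 -> R) C1 C2 :
  0 <= C1 -> (forall x, 0 <= w1 x) ->
  trilinear_bound mul1 w1 C1 -> trilinear_bound mul2 w2 C2 ->
  trilinear_bound (fun x y : T1 * T2 => (mul1 x.1 y.1, mul2 x.2 y.2))
    (fun x => w1 x.1 * w2 x.2) (C1 * C2).
Proof.
move=> C10 w10 H1 H2 s t u phi psi chi us ut uu phi0 psi0 chi0 hu.
pose proj1 (r : seq (T1 * T2)) := undup (map fst r).
pose proj2 (r : seq (T1 * T2)) := undup (map snd r).
pose u1 := undup (map fst u ++ [seq mul1 x y | x <- proj1 s, y <- proj1 t]).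
pose u2 := undup (map snd u ++ [seq mul2 x y | x <- proj2 s, y <- proj2 t]).
(* The lists need not be boxes; extension by zero turns sums over them into double sums. *)
pose res (r : seq (T1 * T2)) (f : T1 * T2 -> R) x := if x \in r then f x else 0.
have res0 r f : (forall x, 0 <= f x) -> forall x, 0 <= res r f x.
  by move=> f0 x; rewrite /res; case: ifP.
have sumE r r1 r2 (f : T1 * T2 -> R) : uniq r -> uniq r1 -> uniq r2 ->
    {subset map fst r <= r1} -> {subset map snd r <= r2} ->
    \sum_(x <- r) f x = \sum_(x2 <- r2) \sum_(x1 <- r1) res r f (x1, x2).
  move=> ur ur1 ur2 h1 h2.
  have uq : uniq [seq (x1, x2) | x1 <- r1, x2 <- r2].
    by apply: allpairs_uniq => // -[? ?] [? ?] _ _.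
  rewrite (@sum_sub_uniq _ r _ f ur uq).
    by rewrite big_mkcond big_allpairs exchange_big.
  move=> [x1 x2] xr; apply/allpairs_f.
    by apply: h1; apply/mapP; exists (x1, x2).
  by apply: h2; apply/mapP; exists (x1, x2).
have p1 r : {subset map fst r <= proj1 r} by move=> x; rewrite mem_undup.
have p2 r : {subset map snd r <= proj2 r} by move=> x; rewrite mem_undup.
have q1 : {subset map fst u <= u1} by move=> x; rewrite mem_undup mem_cat => ->.
have q2 : {subset map snd u <= u2} by move=> x; rewrite mem_undup mem_cat => ->.
pose A x2 := Num.sqrt (\sum_(x1 <- proj1 s) res s phi (x1, x2) ^+ 2 * w1 x1).
pose B x2 := Num.sqrt (\sum_(x1 <- proj1 t) res t psi (x1, x2) ^+ 2).
pose D x2 := Num.sqrt (\sum_(x1 <- u1) res u chi (x1, x2) ^+ 2).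
have eA : \sum_(x <- s) phi x ^+ 2 * (w1 x.1 * w2 x.2) =
    \sum_(x2 <- proj2 s) A x2 ^+ 2 * w2 x2.
  rewrite (sumE s (proj1 s) (proj2 s)) ?undup_uniq //; apply: eq_bigr => x2 _.
  rewrite sqr_sqrtr; last by apply: sumr_ge0 => x1 _; rewrite mulr_ge0 ?sqr_ge0.
  rewrite mulr_suml; apply: eq_bigr => x1 _; rewrite /res; case: ifP => _ /=.
    by rewrite mulrA.
  by rewrite expr0n !mul0r.
have eB r r1 (f : T1 * T2 -> R) r2 : uniq r -> uniq r1 -> uniq r2 ->
    {subset map fst r <= r1} -> {subset map snd r <= r2} ->
    \sum_(x <- r) f x ^+ 2 =
    \sum_(x2 <- r2) Num.sqrt (\sum_(x1 <- r1) res r f (x1, x2) ^+ 2) ^+ 2.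
  move=> ur ur1 ur2 h1 h2; rewrite (sumE r r1 r2) //; apply: eq_bigr => x2 _.
  rewrite sqr_sqrtr; last by apply: sumr_ge0 => x1 _; rewrite sqr_ge0.
  by apply: eq_bigr => x1 _; rewrite /res; case: ifP => //; rewrite expr0n.
rewrite eA (eB t (proj1 t) _ (proj2 t)) ?undup_uniq // (eB u u1 _ u2) ?undup_uniq //.
rewrite -[leRHS]mulrA; apply: (@le_trans _ _ (C1 * \sum_(x2 <- proj2 s) \sum_(y2 <- proj2 t)
    A x2 * B y2 * D (mul2 x2 y2))); last first.
  rewrite ler_wpM2l // H2 ?undup_uniq //; try by move=> x; rewrite sqrtr_ge0.
  by move=> x y xs yt; rewrite mem_undup mem_cat allpairs_f ?orbT.
rewrite (sumE s (proj1 s) (proj2 s)) ?undup_uniq // mulr_sumr.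
apply: (@le_trans _ _ (\sum_(x2 <- proj2 s) \sum_(y2 <- proj2 t)
   \sum_(x1 <- proj1 s) \sum_(y1 <- proj1 t)
   res s phi (x1, x2) * res t psi (y1, y2) * res u chi (mul1 x1 y1, mul2 x2 y2))).
  apply: ler_sum => x2 _; rewrite [leRHS]exchange_big /=.
  apply: ler_sum => x1 _; rewrite /res; case: ifPn => xs; last first.
    by apply: sumr_ge0 => y2 _; apply: sumr_ge0 => y1 _; rewrite !mul0r.
  rewrite (sumE t (proj1 t) (proj2 t)) ?undup_uniq //.
  apply: ler_sum => y2 _; apply: ler_sum => y1 _; rewrite /res.
  by case: ifPn => yt; rewrite ?mulr0 ?mul0r // (hu _ _ xs yt).
apply: ler_sum => x2 _; rewrite mulr_sumr; apply: ler_sum => y2 _.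
apply: H1 => //; rewrite ?undup_uniq //; try by move=> x; apply: res0.
by move=> x y xs yt; rewrite mem_undup mem_cat allpairs_f ?orbT.
Qed.

Lemma trilinear_pullback (T T' : eqType) mul mul' (w' : T' -> R) C (f : T -> T') (x0 : T) :
  injective f -> (forall x y, f (mul x y) = mul' (f x) (f y)) ->
  trilinear_bound mul' w' C -> trilinear_bound mul (w' \o f) C.
Proof.
move=> finj fM H s t u phi psi chi us ut uu phi0 psi0 chi0 hu.
have [g fK] : exists g, cancel f g.
  (* The default [x0] outside the image of [f] is harmless: the transported lists lie in the
     image. *)
  exists (fun y => if pselect (exists x, f x = y) is left h then projT1 (cid h) else x0).
  move=> x; case: pselect => [h|[]]; last by exists x.
  by apply: finj; apply: projT2 (cid h).
have := H (map f s) (map f t) (map f u) (phi \o g) (psi \o g) (chi \o g).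
rewrite !map_inj_uniq // !big_map => /(_ us ut uu).
under eq_bigr do rewrite big_map; under eq_bigr do under eq_bigr do rewrite -fM /= !fK.
under [X in Num.sqrt X * _ * _]eq_bigr do rewrite /= fK.
under [X in _ * Num.sqrt X * _]eq_bigr do rewrite /= fK.
under [X in _ * Num.sqrt X]eq_bigr do rewrite /= fK.
move=> /(_ (fun=> phi0 _) (fun=> psi0 _) (fun=> chi0 _)); apply.
move=> _ _ /mapP[x xs ->] /mapP[y yt ->]; rewrite -fM map_f //; exact: hu.
Qed.

End FiniteSums.

(** * Direct products of the vertex groups *)

Section DirectProduct.
Variables (V : finType) (G : V -> groupType) (R : realType).
Variables (w : forall v, G v -> R) (C : V -> R).
Hypotheses (C_ge0 : forall v, 0 <= C v) (w_ge0 : forall v (a : G v), 0 <= w a).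
Hypothesis G_bound : forall v, trilinear_bound (fun a b : G v => (a * b)%g) (@w v) (C v).

(** Nested pairs give the induction on the number of factors through [trilinear_prod];
    [trilinear_pullback] along [tuple_of] then carries the bound to dependent functions. *)
Fixpoint tuple_over (l : seq V) : eqType :=
  if l is v :: l' then (G v * tuple_over l')%type else unit.

Fixpoint tuple_mul l : tuple_over l -> tuple_over l -> tuple_over l :=
  if l is v :: l' then
    fun x y => ((x.1 * y.1)%g, tuple_mul x.2 y.2)
  else fun _ _ => tt.

Fixpoint tuple_weight l : tuple_over l -> R :=
  if l is v :: l' then fun x => w x.1 * tuple_weight x.2 else fun=> 1.

Fixpoint tuple_of l (s : forall v, G v) : tuple_over l :=
  if l is v :: l' then (s v, tuple_of l' s) else tt.

Lemma trilinear_tuple l :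
  trilinear_bound (@tuple_mul l) (@tuple_weight l) (\prod_(v <- l) C v).
Proof.
elim: l => [|v l ih]; first by rewrite big_nil; apply: trilinear_unit.
by rewrite big_cons; apply: trilinear_prod.
Qed.

Lemma trilinear_dprod :
  trilinear_bound (fun s t : forall v, G v => (fun v => (s v * t v)%g) : forall v, G v)
    (fun s => \prod_v w (s v)) (\prod_v C v).
Proof.
have ewt l (s : forall v, G v) : tuple_weight (tuple_of l s) = \prod_(v <- l) w (s v).
  by elim: l => [|v l ih] /=; rewrite ?big_nil ?big_cons ?ih.
have -> : (fun s : forall v, G v => \prod_v w (s v)) =
    @tuple_weight (enum V) \o tuple_of (enum V).
  by apply: funext => s; rewrite /= ewt big_enum.
rewrite -big_enum.
apply: (@trilinear_pullback _ _ _ _ _ _ _ (tuple_of (enum V)) (fun v => 1%g) _ _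
  (@trilinear_tuple (enum V))).
- move=> s t e; apply: functional_extensionality_dep => v.
  have : v \in enum V by rewrite mem_enum.
  elim: (enum V) e => //= u l ih [e1 /ih {}ih]; rewrite in_cons => /orP[/eqP -> //|].
  exact: ih.
- by move=> s t; elim: (enum V) => //= v l ->.
Qed.

End DirectProduct.

Lemma length_ge0 (R : realType) (H : groupType) (f : H -> R) : length_function f -> forall g, 0 <= f g.
Proof.
move=> [f1 fV fM] g; have := fM g g^-1%g; rewrite mulgV f1 fV -mulr2n.
by rewrite pmulrn_lge0.
Qed.

Local Close Scope ring_scope.
Local Open Scope quotient_scope.
Local Open Scope group_scope.

(** * Reduced words in a graph product *)

Section Words.
Variables (V : finType) (E : rel V) (G : V -> groupType).
Hypotheses (E_sym : symmetric E) (E_irr : irreflexive E).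

Local Notation L := {v : V & G v}.
Local Notation W := (seq {v : V & G v}).
Implicit Types (x y z : {v : V & G v}) (w p q : seq {v : V & G v}) (u v : V).

Definition proj u v w : W := [seq y <- w | (tag y == u) || (tag y == v)].

(* Equality of the projections to all pairs of non-adjacent (possibly equal)
   vertices characterises equality up to shuffling of commuting letters. *)
Definition eqw w w' : Prop := forall u v, ~~ E u v -> proj u v w = proj u v w'.

Lemma eqw_refl w : eqw w w.
Proof. by []. Qed.

Lemma eqw_sym w w' : eqw w w' -> eqw w' w.
Proof. by move=> h u v /h. Qed.

Lemma eqw_trans w w' w'' : eqw w w' -> eqw w' w'' -> eqw w w''.
Proof. by move=> h h' u v uv; rewrite h ?h'. Qed.

Lemma eqw_cat p p' q q' : eqw p p' -> eqw q q' -> eqw (p ++ q) (p' ++ q').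
Proof. by move=> hp hq u v uv; rewrite /proj !filter_cat -!/(proj _ _ _) hp ?hq. Qed.

Lemma eqw_cons x w w' : eqw w w' -> eqw (x :: w) (x :: w').
Proof. by move=> h; apply: (@eqw_cat [:: x] [:: x]). Qed.

Lemma eqw_consI x w w' : eqw (x :: w) (x :: w') -> eqw w w'.
Proof. by move=> h u v /h; rewrite /proj /=; case: ifP => // _ []. Qed.

Lemma eqw_swap x y w : E (tag x) (tag y) -> eqw (x :: y :: w) (y :: x :: w).
Proof.
move=> xy u v uv; rewrite /proj /=.
case: ifP => // hx; case: ifP => // hy.
case/orP: hx => /eqP hx; case/orP: hy => /eqP hy; move: xy uv; rewrite hx hy.
- by rewrite E_irr.
- by move->.
- by rewrite E_sym => ->.
- by rewrite E_irr.
Qed.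

Definition adj v w := all (fun y => E v (tag y)) w.

Lemma adj_cat v p q : adj v (p ++ q) = adj v p && adj v q.
Proof. exact: all_cat. Qed.

Lemma eqw_shift x p q : adj (tag x) p -> eqw (p ++ x :: q) (x :: p ++ q).
Proof.
elim: p => [|y p ih] //= /andP[xy /ih h].
by apply: eqw_trans (eqw_cons y h) _; apply: eqw_swap; rewrite E_sym.
Qed.

Lemma split_first (a : pred L) w : has a w ->
  exists p y q, [/\ w = p ++ y :: q, a y & ~~ has a p].
Proof.
elim: w => [|y w ih] //=; case: (boolP (a y)) => /= [ay _|nay /ih].
  by exists [::], y, w.
move=> [p [z [q [-> az np]]]]; exists (y :: p), z, q; split=> //=.
by rewrite (negPf nay).
Qed.

(** The projection to (v, v) shows that the first letter of type [v] in [w'] is [x]. A letter z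
    before it with [tag z] not adjacent to [v] would precede [x] in the projection to (v, tag z),
    which starts with [x]. *)
Lemma eqw_front x w w' : eqw (x :: w) w' ->
  exists p q, [/\ w' = p ++ x :: q, adj (tag x) p & eqw w (p ++ q)].
Proof.
move=> h; set v := tag x.
have hvv := h v v; rewrite E_irr /proj /= eqxx /= in hvv; have {}hvv := hvv isT.
have hw' : has (fun y => tag y == v) w'.
  apply/hasP; exists x; rewrite // -/v ?eqxx //.
  have : x \in [seq y <- w' | (tag y == v) || (tag y == v)].
    by rewrite -hvv mem_head.
  by rewrite mem_filter => /andP[].
have [p [y [q [ew' /eqP yv np]]]] := split_first hw'.
have pv z : z \in p -> tag z != v.
  by move=> zp; apply/negP => zv; case/negP: np; apply/hasP; exists z.
have exy : x = y.
  move: hvv; rewrite ew' filter_cat /= yv eqxx /=.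
  have -> : [seq z <- p | (tag z == v) || (tag z == v)] = [::].
    by apply/eqP; rewrite -(negbK (_ == _)) -has_filter; apply/hasPn => z /pv;
      rewrite orbb.
  by case.
subst y.
have ap : adj v p.
  apply/allP => z zp; apply/negPn/negP => nz.
  have := h v (tag z) nz; rewrite ew' /proj filter_cat /= eqxx /=.
  case e : [seq y <- p | _] => [|t s] /=.
    have : z \in [seq y <- p | (tag y == v) || (tag y == tag z)].
      by rewrite mem_filter eqxx orbT.
    by rewrite e.
  case=> xt _; have : t \in [seq y <- p | (tag y == v) || (tag y == tag z)].
    by rewrite e mem_head.
  by rewrite -xt mem_filter => /andP[_ /pv]; rewrite eqxx.
exists p, q; split=> //; apply: (@eqw_consI x).
by apply: eqw_trans (eqw_shift _ ap); rewrite -ew'.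
Qed.

(** No vertex is adjacent to itself, so the diagonal projections agree, and together they contain
    each letter exactly once. *)
Lemma big_tag_eqw (T : Type) (idx : T) (op : Monoid.com_law idx) (f : L -> T)
  w w' : eqw w w' -> \big[op/idx]_(y <- w) f y = \big[op/idx]_(y <- w') f y.
Proof.
move=> h; rewrite (partition_big (fun y => tag y) xpredT) //.
rewrite [RHS](partition_big (fun y => tag y) xpredT) //.
apply: eq_bigr => v _; rewrite -big_filter -[RHS]big_filter.
have := h v v; rewrite E_irr /proj => /(_ isT).
under eq_filter do rewrite orbb.
by under [in RHS]eq_filter do rewrite orbb; move=> ->.
Qed.

(** * Front letters, reduced words and multiplication by a letter *)

Definition valat v y : G v := tagged_as (letter (1 : G v)) y.

Lemma valatE v (a : G v) : valat v (letter a) = a.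
Proof. exact: (tagged_asE (u := letter (1 : G v)) a). Qed.

(* [hd v w] is the letter of type [v] that can be shuffled to the front of [w],
   or [1] if there is none; [tl v w] is what remains. *)
Fixpoint hd v w : G v :=
  if w is y :: w' then
    if tag y == v then valat v y else if E v (tag y) then hd v w' else 1
  else 1.

Fixpoint tl v w : W :=
  if w is y :: w' then
    if tag y == v then w' else if E v (tag y) then y :: tl v w' else w
  else [::].

Definition cons1 v (c : G v) w : W := if c == 1 then w else letter c :: w.

(** Left multiplication by a letter on reduced words: [a] absorbs the letter of its vertex that can
    reach the front, and a trivial product disappears. *)
Definition push v (a : G v) w : W := cons1 (a * hd v w) (tl v w).

(** No letter is trivial, and none can be shuffled next to a later letter of its own vertex. *)
Fixpoint red w : bool :=
  if w is y :: w' then [&& tagged y != 1, hd (tag y) w' == 1 & red w'] else true.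

Lemma E_neq u v : E u v -> (v == u) = false.
Proof. by apply: contraTF => /eqP ->; rewrite E_irr. Qed.

Lemma valat_eq1 v y : tag y = v -> (valat v y == 1) = (tagged y == 1).
Proof. by case: y => u a /= uv; subst u; rewrite valatE. Qed.

Lemma letter_valat v y : tag y = v -> letter (valat v y) = y.
Proof. by case: y => u a /= uv; subst u; rewrite valatE. Qed.

Lemma tl_id v w : red w -> hd v w = 1 -> tl v w = w.
Proof.
elim: w => [|y w ih] //= /and3P[y1 _ /ih {}ih].
case: eqP => [yv /eqP|_]; first by rewrite valat_eq1 // (negPf y1).
by case: ifP => // _ /ih ->.
Qed.

Lemma eqw_hdtl v w : red w -> eqw w (cons1 (hd v w) (tl v w)).
Proof.
elim: w => [|y w ih] /=; first by rewrite /cons1 eqxx.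
move=> /and3P[y1 _ /ih {}ih].
case: eqP => [yv|nyv].
  by rewrite /cons1 valat_eq1 // (negPf y1) letter_valat.
case: ifP => [vy|_]; last by rewrite /cons1 eqxx.
apply: eqw_trans (eqw_cons y ih) _; rewrite /cons1; case: eqP => // _.
by apply: eqw_swap; rewrite E_sym.
Qed.

Lemma hd_tl v w : red w -> hd v (tl v w) = 1.
Proof.
elim: w => [|y w ih] //= /and3P[y1 /eqP hy rw].
case: eqP => [<- //|/eqP nyv]; case: ifP => [vy|nvy] /=.
  by rewrite (negPf nyv) vy ih.
by rewrite (negPf nyv) nvy.
Qed.

Lemma hd_comm u v w : E u v -> hd u (tl v w) = hd u w.
Proof.
move=> uv; elim: w => [|y w ih] //=.
have [->|yv] := eqVneq (tag y) v; first by rewrite E_neq // uv.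
by case: (boolP (E v _)) => //= _; rewrite ih.
Qed.

Lemma tl_comm u v w : E u v -> tl u (tl v w) = tl v (tl u w).
Proof.
move=> uv; have vu : E v u by rewrite E_sym.
elim: w => [|y w ih] //=.
have [yv|yv] := eqVneq (tag y) v.
  by rewrite yv E_neq // uv /= yv eqxx.
have [yu|yu] := eqVneq (tag y) u; first by rewrite yu vu /= yu eqxx.
case vy: (E v (tag y)); case uy : (E u (tag y)); rewrite /= ?(negPf yu) ?(negPf yv) ?vy ?uy //=.
by rewrite ih.
Qed.

Lemma red_tl v w : red w -> red (tl v w).
Proof.
elim: w => [|y w ih] //= /and3P[y1 hy rw]; case: eqP => // _.
case: ifP => /= [vy|_]; last by rewrite y1 hy.
by rewrite y1 ih // hd_comm ?hy // E_sym.
Qed.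

Lemma red_cons1 v (c : G v) w : red w -> hd v w = 1 -> red (cons1 c w).
Proof. by rewrite /cons1; case: ifP => //= -> -> ->; rewrite eqxx. Qed.

Lemma red_push v (a : G v) w : red w -> red (push a w).
Proof. by move=> rw; apply: red_cons1; rewrite ?hd_tl ?red_tl. Qed.

Lemma hd_skip v p q : adj v p -> hd v (p ++ q) = hd v q.
Proof.
by elim: p => [|y p ih] //= /andP[vy /ih ->]; rewrite vy E_neq.
Qed.

Lemma hd_insert v x p q : E v (tag x) -> hd v (p ++ x :: q) = hd v (p ++ q).
Proof.
move=> vx; elim: p => [|y p /= -> //].
by rewrite /= vx E_neq.
Qed.

Lemma hd_block v x p q : ~~ E v (tag x) -> tag x != v -> adj (tag x) p ->
  hd v (p ++ x :: q) = 1.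
Proof.
move=> vx xv; elim: p => [|y p ih] /=; first by rewrite (negPf xv) (negPf vx).
move=> /andP[xy /ih ->]; have [yv|_] := eqVneq; last by rewrite if_same.
by move: vx; rewrite E_sym -yv xy.
Qed.

Lemma hd_eqw v w w' : eqw w w' -> hd v w = hd v w'.
Proof.
elim: w w' => [|x w ih] w' h.
  case: w' h => [|y w'] // /(_ (tag y) (tag y)).
  by rewrite E_irr /proj /= eqxx => /(_ isT).
have [p [q [-> ap h']]] := eqw_front h => /=.
have [xv|xv] := eqVneq.
  by rewrite hd_skip /= ?xv ?eqxx // -xv.
case: (boolP (E v (tag x))) => vx; first by rewrite hd_insert // (ih _ h').
by rewrite hd_block.
Qed.

Lemma red_insert x p q : adj (tag x) p -> red (p ++ q) -> tagged x != 1 ->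
  hd (tag x) q = 1 -> red (p ++ x :: q).
Proof.
move=> + + x1 hx; elim: p => [|y p ih] /=; first by rewrite x1 hx eqxx.
move=> /andP[xy /ih {}ih] /and3P[-> hy /ih ->].
by rewrite hd_insert ?hy // E_sym.
Qed.

Lemma red_eqw w w' : eqw w w' -> red w -> red w'.
Proof.
elim: w w' => [|x w ih] w' h.
  case: w' h => [|y w'] // /(_ (tag y) (tag y)).
  by rewrite E_irr /proj /= eqxx => /(_ isT).
have [p [q [-> ap h']]] := eqw_front h => /= /and3P[x1 hx /(ih _ h') rpq].
apply: red_insert => //; rewrite -(hd_skip _ ap) -(hd_eqw _ h'); exact/eqP.
Qed.

Lemma tl_eqw v w w' : red w -> eqw w w' -> eqw (tl v w) (tl v w').
Proof.
move=> rw h; have rw' := red_eqw h rw; have e := hd_eqw v h.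
have := eqw_trans (eqw_sym (eqw_hdtl v rw)) (eqw_trans h (eqw_hdtl v rw')).
by rewrite -e /cons1; case: ifP => // _ /eqw_consI.
Qed.

Lemma cons1_eqw v (c : G v) w w' : eqw w w' -> eqw (cons1 c w) (cons1 c w').
Proof. by rewrite /cons1; case: ifP => // _; apply: eqw_cons. Qed.

Lemma push_eqw v (a : G v) w w' : red w -> eqw w w' -> eqw (push a w) (push a w').
Proof.
by move=> rw h; rewrite /push (hd_eqw v h); apply/cons1_eqw/tl_eqw.
Qed.

Lemma hd_cons1 v (c : G v) w : hd v w = 1 -> hd v (cons1 c w) = c.
Proof. by rewrite /cons1; case: eqP => [->|_] //=; rewrite eqxx valatE. Qed.

Lemma tl_cons1 v (c : G v) w : red w -> hd v w = 1 -> tl v (cons1 c w) = w.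
Proof.
by move=> rw hw; rewrite /cons1; case: eqP => [_|_] /=; rewrite ?tl_id ?eqxx.
Qed.

Lemma push_mul v (a b : G v) w : red w -> push a (push b w) = push (a * b) w.
Proof.
move=> rw; rewrite /push hd_cons1 ?hd_tl // tl_cons1 ?hd_tl ?red_tl //.
by rewrite mulgA.
Qed.

Lemma push1 v w : red w -> eqw (push (1 : G v) w) w.
Proof. by move=> rw; rewrite /push mul1g; apply/eqw_sym/eqw_hdtl. Qed.

Lemma hd_cons1_adj u v (c : G v) w : E u v -> hd u (cons1 c w) = hd u w.
Proof. by move=> uv; rewrite /cons1; case: ifP => //= _; rewrite E_neq ?uv. Qed.

Lemma tl_cons1_adj u v (c : G v) w : E u v -> tl u (cons1 c w) = cons1 c (tl u w).
Proof. by move=> uv; rewrite /cons1; case: ifP => //= _; rewrite E_neq ?uv. Qed.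

Lemma cons1_comm u v (a : G u) (b : G v) w : E u v ->
  eqw (cons1 a (cons1 b w)) (cons1 b (cons1 a w)).
Proof.
by move=> uv; rewrite /cons1; case: ifP => // _; case: ifP => // _; apply: eqw_swap.
Qed.

Lemma push_comm u v (a : G u) (b : G v) w : E u v ->
  eqw (push a (push b w)) (push b (push a w)).
Proof.
move=> uv; have vu : E v u by rewrite E_sym.
rewrite /push !hd_cons1_adj // !tl_cons1_adj // !hd_comm // (tl_comm _ uv).
exact: cons1_comm.
Qed.

(* Letters act on reduced words; as this action respects the defining relations,
   a reduced word is recovered, up to shuffling, from its value in the group. *)
Definition act (s w : W) : W := foldr (fun x => push (tagged x)) w s.

Lemma act_cat s t w : act (s ++ t) w = act s (act t w).
Proof. exact: foldr_cat. Qed.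

Lemma red_act s w : red w -> red (act s w).
Proof. by move=> rw; elim: s => //= x s ih; apply: red_push. Qed.

Lemma act_eqw s w w' : red w -> eqw w w' -> eqw (act s w) (act s w').
Proof. by move=> rw h; elim: s => //= x s ih; apply: push_eqw; rewrite ?red_act. Qed.

Lemma act_fp_rel s t w : fp_rel s t -> red w -> eqw (act s w) (act t w).
Proof.
move=> h; elim: h w => {s t} [s w|s t _ h w rw|s t u _ h _ h' w rw|v s t w rw|v a b s t w rw] //.
- by apply/eqw_sym/h.
- exact: eqw_trans (h _ rw) (h' _ rw).
- rewrite !act_cat /=; apply: act_eqw; first by rewrite red_push ?red_act.
  by apply: push1; apply: red_act.
- rewrite !act_cat /=; apply: act_eqw; first by rewrite !red_push ?red_act.
  by rewrite push_mul ?red_act.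
Qed.

(** In a reduced word no letter meets one of its own vertex when pushed, so the word is rebuilt
    literally and not just up to shuffling. *)
Lemma act_nil w : red w -> act w [::] = w.
Proof.
elim: w => [|x w ih] //= /and3P[x1 /eqP hx rw]; rewrite ih //.
by rewrite /push hx mulg1 tl_id // /cons1 (negPf x1); case: (x).
Qed.

(** * Prefixes and letter counts *)

Definition cnt w u := count (fun y => tag y == u) w.

(** Keeping the first [n u] letters of each type [u] commutes with every projection, which makes
    prefixes comparable up to shuffling. *)
Fixpoint takew (n : V -> nat) w : W :=
  if w is y :: w' then
    let w'' := takew (fun u => n u - (tag y == u)) w' in
    if 0 < n (tag y) then y :: w'' else w''
  else [::].

Lemma eq_takew n n' w : (forall y, y \in w -> n (tag y) = n' (tag y)) ->
  takew n w = takew n' w.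
Proof.
elim: w n n' => [|y w ih] n n' h //=.
rewrite h ?mem_head // (ih _ (fun u => n' u - (tag y == u))) // => z zw.
by rewrite h // in_cons zw orbT.
Qed.

Lemma proj_takew u v n w : proj u v (takew n w) = takew n (proj u v w).
Proof.
rewrite /proj; elim: w n => [|y w ih] n //=.
case: (boolP ((tag y == u) || (tag y == v))) => hy /=; case: (0 < n (tag y));
  rewrite /= ?(negPf hy) ?hy ih //.
all: apply: eq_takew => z; rewrite mem_filter => /andP[hz _];
  suff /negPf -> : tag y != tag z by rewrite subn0.
all: by apply: contra hy => /eqP ->.
Qed.

Lemma takew0 n w : (forall u, n u = 0) -> takew n w = [::].
Proof.
elim: w n => [|y w ih] n h //=; rewrite h ih // => u; by rewrite h.
Qed.

Lemma takew_cat n p q : (forall u, n u = cnt p u) -> takew n (p ++ q) = p.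
Proof.
elim: p n => [|y p ih] n h /=; first exact: takew0.
by rewrite h /= eqxx ih // => u; rewrite h /= addKn.
Qed.

(* Reduced words form heaps in which the letters of each vertex are linearly
   ordered, so a prefix is determined by its number of letters of each type. *)
Lemma eqw_prefix p p' q q' : eqw (p ++ q) (p' ++ q') ->
  (forall u, cnt p u = cnt p' u) -> eqw p p'.
Proof.
move=> h hc u v uv; rewrite -(@takew_cat (cnt p) p q) // proj_takew h //.
by rewrite -proj_takew takew_cat.
Qed.

(** * Elements of the direct product as words *)

Definition dprod := forall v : V, G v.

Definition mulD (s t : dprod) : dprod := fun v => s v * t v.

Definition updD (s : dprod) v (a : G v) : dprod :=
  fun u => if u == v then valat u (letter a) else s u.

Lemma updD_same s v (a : G v) : updD s a v = a.
Proof. by rewrite /updD eqxx valatE. Qed.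

Lemma updD_neq s v (a : G v) u : u != v -> updD s a u = s u.
Proof. by rewrite /updD => /negPf ->. Qed.

Lemma mulD_upd s t v (a b : G v) :
  mulD (updD s a) (updD t b) = updD (mulD s t) (a * b).
Proof.
apply: functional_extensionality_dep => u; rewrite /mulD.
have [->|uv] := eqVneq u v; first by rewrite !updD_same.
by rewrite !updD_neq.
Qed.

Definition lets_on (l : seq V) (s : dprod) : W :=
  [seq letter (s v) | v <- l & s v != 1].

Definition lets (s : dprod) : W := lets_on (enum V) s.

Lemma lets1 : lets (fun v => 1) = [::].
Proof. by rewrite /lets /lets_on; elim: (enum V) => //= v l; rewrite eqxx. Qed.

Lemma eqw_lets_upd s v (a : G v) : s v = 1 -> a != 1 -> adj v (lets s) ->
  eqw (lets (updD s a)) (letter a :: lets s).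
Proof.
move=> sv a1; rewrite /lets.
have : v \in enum V by rewrite mem_enum.
have := enum_uniq V; set l := enum V => ul vl.
have {ul vl} [l1 [l2 [-> n1 n2]]] : exists l1 l2, [/\ l = l1 ++ v :: l2, v \notin l1 & v \notin l2].
  case/splitPr: vl ul => l1 l2; rewrite cat_uniq /= negb_or.
  by case/and3P=> _ /andP[vl1 _] /andP[vl2 _]; exists l1, l2.
have hu l' : v \notin l' -> lets_on l' (updD s a) = lets_on l' s.
  elim: l' => [|u l' ih] //; rewrite in_cons negb_or eq_sym => /andP[uv /ih h].
  have hs s' : lets_on (u :: l') s' =
      if s' u == 1 then lets_on l' s' else letter (s' u) :: lets_on l' s'.
    by rewrite /lets_on /=; case: (s' u == 1).
  by rewrite !hs h updD_neq.
have hc l1' l2' s' : lets_on (l1' ++ l2') s' = lets_on l1' s' ++ lets_on l2' s'.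
  by rewrite /lets_on filter_cat map_cat.
rewrite !hc adj_cat => /andP[al1 _]; rewrite (hu l1) //.
have -> : lets_on (v :: l2) s = lets_on l2 s by rewrite /lets_on /= sv eqxx.
have -> : lets_on (v :: l2) (updD s a) = letter a :: lets_on l2 s.
  by rewrite -(hu l2) // /lets_on /= updD_same a1 /= updD_same.
exact: eqw_shift.
Qed.

Lemma adj_lets s t v : (forall u, (s u == 1) = (t u == 1)) ->
  adj v (lets s) = adj v (lets t).
Proof.
move=> st; rewrite /lets /lets_on; elim: (enum V) => //= u l.
by rewrite st; case: ifP => //= _ ->.
Qed.

Lemma hd_lets s t v : (forall u, (s u == 1) = (t u == 1)) ->
  (hd v (lets s) == 1) = (hd v (lets t) == 1).
Proof.
move=> st; rewrite /lets /lets_on; elim: (enum V) => //= u l ih.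
rewrite -st; case: (s u == 1) => //=; have [uv|_] := eqVneq u v.
  by rewrite !valat_eq1 // st.
by case: (E v u) => //; rewrite !eqxx.
Qed.

Lemma adj_lets1 s v : adj v (lets s) -> s v = 1.
Proof.
move=> h; apply/eqP/negPn/negP => sv.
have /(allP h) /= : letter (s v) \in lets s; last by rewrite E_irr.
by apply/mapP; exists v; rewrite // mem_filter sv mem_enum.
Qed.

Lemma proj_lets v s : proj v v (lets s) = if s v == 1 then [::] else [:: letter (s v)].
Proof.
suff h l : uniq l -> proj v v (lets_on l s) =
    if (v \in l) && (s v != 1) then [:: letter (s v)] else [::].
  by rewrite h ?enum_uniq // mem_enum /=; case: (s v == 1).
rewrite /proj /lets_on; elim: l => //= u l ih /andP[ul /ih {}ih].
have [uv|uv] := eqVneq u v.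
  subst u; rewrite mem_head /=; have [s1|s1] := boolP (s v == 1).
    by rewrite ih s1 andbF.
  by rewrite /= eqxx ih (negPf ul).
rewrite in_cons (eq_sym v) (negPf uv) /=.
by case: (s u == 1); rewrite //= (negPf uv).
Qed.

Lemma lets_inj s t : eqw (lets s) (lets t) -> s = t.
Proof.
move=> h; apply: functional_extensionality_dep => v.
have := h v v; rewrite E_irr !proj_lets => /(_ isT).
do 2![case: eqP => [->|_] //] => -[].
by move=> /(congr1 (valat v)); rewrite !valatE.
Qed.

Lemma hd_cat v p q : hd v (p ++ q) = if adj v p then hd v q else hd v p.
Proof.
elim: p => [|y p ih] //=; have [->|_] := eqVneq; first by rewrite E_irr.
by case: (E v (tag y)).
Qed.

(** * Evaluation in the graph product and normal forms *)

Local Notation GP := (graph_product E G).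

Definition eval w : GP :=
  \pi_(ncl_quotient (@edge_commutators V E G)) (\pi_(free_product G) w).

Lemma eval_cat p q : eval (p ++ q) = eval p * eval q.
Proof. by rewrite /eval -fp_prod_pi -ncl_prod_pi. Qed.

Lemma eval_nil : eval [::] = 1.
Proof. by []. Qed.

Lemma eval_cons x w : eval (x :: w) = eval [:: x] * eval w.
Proof. by rewrite -eval_cat. Qed.

Lemma eval_fp_rel s t : fp_rel s t -> eval s = eval t.
Proof. by move=> /fp_eqP /eqP h; rewrite /eval h. Qed.

Lemma eval_letterM v (a b : G v) :
  eval [:: letter (a * b)] = eval [:: letter a] * eval [:: letter b].
Proof.
by rewrite -eval_cat; apply/eval_fp_rel/fp_sym; apply: (fp_mul _ _ [::] [::]).
Qed.

Lemma eval_letter1 v : eval [:: letter (1 : G v)] = 1.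
Proof. by apply: eval_fp_rel; apply: (fp_one _ [::] [::]). Qed.

Lemma eval_invw w : eval (invw w) = (eval w)^-1.
Proof.
apply/eqP; rewrite -mulg_eq1 -eval_cat; apply/eqP.
by apply/eval_fp_rel/fp_rel_mulVw.
Qed.

Lemma eval_comm x y : E (tag x) (tag y) ->
  eval [:: x] * eval [:: y] = eval [:: y] * eval [:: x].
Proof.
case: x y => [u a] [v b] /= uv.
rewrite -!eval_cat /eval; apply/eqP; rewrite eq_sym; apply/ncl_eqP.
have -> : (\pi_(free_product G) [:: letter b; letter a])^-1 *
          \pi_(free_product G) [:: letter a; letter b] = [~ fp_in a, fp_in b].
  have e (c d : {v : V & G v}) : \pi_(free_product G) [:: c; d] =
     \pi_(free_product G) [:: c] * \pi_(free_product G) [:: d].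
    by rewrite -[[:: c; d]]/([:: c] ++ [:: d]) -fp_prod_pi.
  by rewrite !e invgM commgEl conjgE !mulgA.
by apply: sub_gen_smallest; exists u, v, a, b.
Qed.

Lemma eval_eqw w w' : eqw w w' -> eval w = eval w'.
Proof.
elim: w w' => [|x w ih] w' h.
  case: w' h => [|y w'] // /(_ (tag y) (tag y)).
  by rewrite E_irr /proj /= eqxx => /(_ isT).
have [p [q [-> ap /ih h']]] := eqw_front h.
rewrite eval_cons h' !eval_cat (eval_cons x q) !mulgA; congr (_ * _).
elim: p ap {h h'} => [|y p ihp] /=; first by rewrite eval_nil mul1g mulg1.
by move=> /andP[/eval_comm xy /ihp h]; rewrite (eval_cons y) mulgA xy -!mulgA h.
Qed.

Lemma eval_cons1 v (c : G v) w : eval (cons1 c w) = eval [:: letter c] * eval w.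
Proof.
rewrite /cons1; case: eqP => [->|_]; last exact: eval_cons.
by rewrite eval_letter1 mul1g.
Qed.

Lemma eval_push v (a : G v) w : red w -> eval (push a w) = eval [:: letter a] * eval w.
Proof.
move=> rw; rewrite eval_cons1 eval_letterM -mulgA; congr (_ * _).
by rewrite -eval_cons1; apply/esym/eval_eqw/eqw_hdtl.
Qed.

Lemma eval_act s w : red w -> eval (act s w) = eval s * eval w.
Proof.
move=> rw; elim: s => [|x s ih] /=; first by rewrite eval_nil mul1g.
by rewrite eval_push ?red_act // ih (eval_cons x) mulgA; case: (x).
Qed.

Definition actF (z : free_product G) w := act (repr z) w.

Lemma actF_pi s w : red w -> eqw (actF (\pi_(free_product G) s) w) (act s w).
Proof. by move=> rw; apply: act_fp_rel => //; apply: fp_repr. Qed.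

Lemma actF_mul (x y : free_product G) w : red w -> eqw (actF (x * y) w) (actF x (actF y w)).
Proof. by move=> rw; rewrite /actF -act_cat; apply: actF_pi. Qed.

Lemma red_actF (z : free_product G) w : red w -> red (actF z w).
Proof. exact: red_act. Qed.

Lemma actF_eqw (z : free_product G) w w' : red w -> eqw w w' -> eqw (actF z w) (actF z w').
Proof. exact: act_eqw. Qed.

Lemma actFK (z : free_product G) w : red w -> eqw (actF z^-1 (actF z w)) w.
Proof.
move=> rw; apply: eqw_trans (eqw_sym (actF_mul _ _ rw)) _.
by rewrite mulVg; apply: (@actF_pi [::]).
Qed.

Lemma actF_in v (a : G v) w : red w -> eqw (actF (fp_in a) w) (push a w).
Proof. exact: actF_pi. Qed.

(** The elements that fix all reduced words up to shuffling form a normal subgroup, and [push_comm]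
    puts every edge commutator into it; hence it contains the normal closure. *)
Lemma closure_actF (z : free_product G) w : normal_closure (@edge_commutators V E G) z -> red w ->
  eqw (actF z w) w.
Proof.
pose N := [set z : free_product G | forall w, red w -> eqw (actF z w) w]%classic.
suff: normal_subgroup N /\ (@edge_commutators V E G `<=` N)%classic.
  by move=> hN hz rw; exact: (hz N hN w rw).
have NV (x : free_product G) : N x -> N x^-1.
  move=> hx {}w rw; apply: eqw_trans (actFK x rw).
  by apply: actF_eqw => //; apply/eqw_sym/hx.
have NM (x y : free_product G) : N x -> N y -> N (x * y).
  move=> hx hy {}w rw; apply: eqw_trans (actF_mul _ _ rw) _.
  by apply: eqw_trans (hx _ (red_actF _ rw)) _; apply: hy.
split; first split=> // [{}w rw|x y hx {}w rw].
- exact: (@actF_pi [::]).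
- rewrite conjgE; apply: eqw_trans (actF_mul _ _ rw) _.
  apply: eqw_trans (actFK y rw); apply: actF_eqw; first exact: red_actF.
  apply: eqw_trans (actF_mul _ _ rw) _; apply: hx; exact: red_actF.
move=> _ [u [v [a [b [uv ->]]]]] {}w rw.
set x := fp_in a; set y := fp_in b.
have -> : [~ x, y] = (y * x)^-1 * (x * y) by rewrite commgEl conjgE invgM !mulgA.
apply: eqw_trans (actF_mul _ _ rw) _.
apply: eqw_trans (actFK (y * x) rw); apply: actF_eqw; first exact: red_actF.
apply: eqw_trans (actF_mul _ _ rw) _; apply: eqw_trans (eqw_sym (actF_mul _ _ rw)).
have h v1 v2 (c : G v1) (d : G v2) :
    eqw (actF (fp_in c) (actF (fp_in d) w)) (push c (push d w)).
  apply: eqw_trans (actF_in _ (red_actF _ rw)) _.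
  by apply: push_eqw; [apply: red_actF|apply: actF_in].
apply: eqw_trans (h _ _ _ _) _; apply: eqw_trans (eqw_sym (h _ _ _ _)).
exact: push_comm.
Qed.

(** The word depends on chosen representatives in the free product and among its words, so it is
    compared with other words up to [eqw] only. *)
Definition nf (g : GP) : W := actF (repr g) [::].

Lemma red_nf g : red (nf g).
Proof. exact: red_actF. Qed.

Lemma nf_act w : eqw (nf (eval w)) (act w [::]).
Proof.
apply: eqw_trans (@actF_pi w [::] isT).
have hN := @ncl_repr _ (@edge_commutators V E G) (\pi_(free_product G) w).
rewrite /nf; set x := repr (eval w) in hN *; set y := \pi_(free_product G) w in hN *.
have -> : y = x * (x^-1 * y) by rewrite mulVKg.
apply: eqw_sym; apply: eqw_trans (@actF_mul _ _ [::] isT) _.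
by apply: actF_eqw; [apply: red_actF|apply: closure_actF].
Qed.

(** The normal form theorem: reduced words with the same value are shuffles of one another. *)
Lemma nf_eval w : red w -> eqw (nf (eval w)) w.
Proof. by move=> rw; rewrite -{2}(act_nil rw); apply: nf_act. Qed.

Lemma eval_nf g : eval (nf g) = g.
Proof.
rewrite -[RHS]reprK -[X in _ = \pi X]reprK; rewrite -/(eval (repr (repr g))).
by rewrite /nf /actF eval_act // eval_nil mulg1.
Qed.

(** * Cancellation in products and factorisations of an element *)

Lemma red_catr p q : red (p ++ q) -> red q.
Proof. by elim: p => [|y p ih] //= /and3P[_ _ /ih]. Qed.

Lemma red_catl p q : red (p ++ q) -> red p.
Proof.
elim: p => [|y p ih] //= /and3P[-> + /ih ->] /=; rewrite andbT hd_cat.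
by case: ifP => // ap _; rewrite -(cats0 p) hd_skip.
Qed.

Lemma eqw_catI p q q' : eqw (p ++ q) (p ++ q') -> eqw q q'.
Proof. by elim: p => //= y p ih /eqw_consI. Qed.

Lemma eqw_shift_cat x p q r : adj (tag x) p -> adj (tag x) q ->
  eqw (p ++ q ++ x :: r) (x :: p ++ q ++ r).
Proof.
move=> hp hq; rewrite !catA; apply: eqw_shift.
by rewrite adj_cat hp.
Qed.

(* [c] is the maximal cancellation in the product; [s] and [t] collect the
   syllables of the two factors that merge without cancelling. *)
Lemma product_decomposition p q : red p -> red q ->
  exists p1 c q1 s t, [/\ eqw p (p1 ++ lets s ++ c),
    eqw q (invw c ++ lets t ++ q1),
    red (p1 ++ lets (mulD s t) ++ q1),
    eval (p1 ++ lets (mulD s t) ++ q1) = eval p * eval q &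
    forall u, (s u == 1) = (t u == 1) /\ (mulD s t u == 1) = (t u == 1)].
Proof.
move=> + rq; elim: p => [|[v a] p ih] /=.
  move=> _; exists [::], [::], q, (fun=> 1), (fun=> 1).
  have -> : mulD (fun=> 1) (fun=> 1) = (fun=> 1).
    by apply: functional_extensionality_dep => u; rewrite /mulD mulg1.
  by rewrite !lets1 /= eval_nil mul1g; split=> //; split; rewrite !eqxx.
move=> /and3P[a1 /eqP hp rp].
have [p1 [c [q1 [s [t [ep eq rw ew hst]]]]]] := ih rp.
rewrite -/(letter a) (eval_cons (letter a)) -mulgA -ew.
set w := p1 ++ _ ++ _ in rw ew *.
have e0 : eqw (letter a :: p) (letter a :: p1 ++ lets s ++ c) by apply: eqw_cons.
have [hw|hw] := eqVneq (hd v w) 1.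
  exists (letter a :: p1), c, q1, s, t; split=> //=; last exact: eval_cons.
  by rewrite a1 -/w hw eqxx.
have hs u : (s u == 1) = (t u == 1) by case: (hst u).
have hm u : (mulD s t u == 1) = (s u == 1) by case: (hst u) => ->.
(* The letter of [w] that [a] meets must come from [q1]. If it came from [p1] or from the merged
   letters, [a] would already meet a letter in [p], because [s] and [mulD s t] have the same
   support; but [a :: p] is reduced. *)
move: hp hw; rewrite (hd_eqw v ep) /w !hd_cat -(adj_lets v hm).
case: (boolP (adj v p1)) => [ap1|_ ->]; last by rewrite eqxx.
have := hd_lets v hm.
case: (boolP (adj v (lets (mulD s t)))) => [am _|_ -> ->]; last by rewrite eqxx.
have as_ : adj v (lets s) by rewrite -(adj_lets v hm).
have at_ : adj v (lets t) by rewrite -(adj_lets v hs).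
have s1 := adj_lets1 as_; have t1 := adj_lets1 at_.
set b := hd v q1 => _ b1.
have rq1 : red q1.
  have : red (invw c ++ lets t ++ q1) by apply: red_eqw rq.
  by rewrite catA; apply: red_catr.
have eq1 : eqw q1 (letter b :: tl v q1).
  by have := eqw_hdtl v rq1; rewrite /cons1 -/b (negPf b1).
set q2 := tl v q1 in eq1.
pose w2 := p1 ++ lets (mulD s t) ++ q2.
have eww : eqw w (letter b :: w2).
  apply: eqw_trans (@eqw_shift_cat (letter b) _ _ _ ap1 am).
  by do 2![apply: eqw_cat => //].
have /= /and3P[_ /eqP hw2 rw2] := red_eqw eww rw.
have eqt : eqw q (invw c ++ letter b :: lets t ++ q2).
  apply: eqw_trans eq _; apply: eqw_cat => //.
  apply: eqw_trans (eqw_cat (eqw_refl (lets t)) eq1) _.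
  exact: (@eqw_shift (letter b)).
have evw : eval w = eval [:: letter b] * eval w2.
  by rewrite (eval_eqw eww) eval_cons.
rewrite evw mulgA -eval_letterM.
have [ab|ab] := eqVneq (a * b) 1.
  (* Here [b] is the inverse of [a]: the cancelled part grows at its left end, its inverse at the
     right end. *)
  exists p1, (letter a :: c), q2, s, t; split=> //.
  - apply: eqw_trans e0 _; apply: eqw_sym; exact: (@eqw_shift_cat (letter a)).
  - rewrite invw_cons -catA /= /invl /=.
    by have -> : a^-1 = b by apply: mulg1_eq.
  - by rewrite ab eval_letter1 mul1g.
(* Here [a] and [b] merge without cancelling and fill the coordinate [v], so far trivial in [s] and
   [t]. *)
exists p1, c, q2, (updD s a), (updD t b); rewrite mulD_upd.
have m1 : mulD s t v = 1 by rewrite /mulD s1 t1 mulg1.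
have el (r r' : dprod) (x : G v) l l' : adj v l -> adj v (lets r) -> r v = 1 -> x != 1 ->
    eqw (l ++ lets (updD r x) ++ l') (letter x :: l ++ lets r ++ l').
  move=> hl hr rv x1; apply: eqw_trans (@eqw_shift_cat (letter x) l (lets r) l' hl hr).
  apply: eqw_cat => //.
  apply: eqw_trans (eqw_cat (eqw_lets_upd rv x1 hr) (eqw_refl l')) _.
  by apply: eqw_sym; apply: (@eqw_shift (letter x)).
have ewab : eqw (p1 ++ lets (updD (mulD s t) (a * b)) ++ q2) (letter (a * b) :: w2).
  exact: el.
split.
- by apply: eqw_trans e0 _; apply/eqw_sym/el.
- apply: eqw_trans eqt _; apply: eqw_cat => //; apply: eqw_sym.
  exact: (el _ t b [::]).
- by apply: red_eqw (eqw_sym ewab) _; rewrite /= ab hw2 eqxx.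
- by rewrite (eval_eqw ewab) eval_cons.
- move=> u; have [->|uv] := eqVneq u v.
    by rewrite !updD_same (negPf a1) (negPf b1) (negPf ab).
  by rewrite !updD_neq.
Qed.

Definition valid (a : GP) (s : dprod) (b : GP) := red (nf a ++ lets s ++ nf b).

Definition assemble (a : GP) (s : dprod) (b : GP) : GP := a * eval (lets s) * b.

Lemma nf_assemble a s b : valid a s b ->
  eqw (nf (assemble a s b)) (nf a ++ lets s ++ nf b).
Proof.
move=> h; apply: eqw_trans (nf_eval h).
by rewrite !eval_cat !eval_nf /assemble mulgA.
Qed.

Lemma valid_eval p s q : red (p ++ lets s ++ q) -> valid (eval p) s (eval q).
Proof.
move=> h; have rp : red p by apply: red_catl h.
have rq : red q by move: h; rewrite catA; apply: red_catr.
apply: red_eqw h; apply: eqw_sym; apply: eqw_cat (nf_eval rp) _.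
by apply: eqw_cat (nf_eval rq).
Qed.

Lemma product_assemble (g h : GP) : exists a c b s t,
  [/\ valid a s c, g = assemble a s c, valid c^-1 t b, h = assemble c^-1 t b &
    valid a (mulD s t) b /\ g * h = assemble a (mulD s t) b].
Proof.
have [p1 [c [q1 [s [t [ep eq rw ew _]]]]]] := product_decomposition (red_nf g) (red_nf h).
have rp := red_eqw ep (red_nf g); have rq := red_eqw eq (red_nf h).
exists (eval p1), (eval c), (eval q1), s, t; rewrite -eval_invw.
split; [exact: valid_eval| |exact: valid_eval| |split; first exact: valid_eval].
- by rewrite -{1}(eval_nf g) (eval_eqw ep) !eval_cat mulgA.
- by rewrite -{1}(eval_nf h) (eval_eqw eq) !eval_cat mulgA.
- by rewrite -{1}(eval_nf g) -{1}(eval_nf h) -ew !eval_cat mulgA.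
Qed.

(** The letter counts fix the prefix [a] by [eqw_prefix]. The support of [s] gives the counts of the
    longer prefix [a s], so [s] is fixed too, and [b] follows by cancellation. *)
Lemma assemble_inj a s b a' s' b' : valid a s b -> valid a' s' b' ->
  assemble a s b = assemble a' s' b' ->
  (forall u, cnt (nf a) u = cnt (nf a') u) ->
  (forall u, (s u == 1) = (s' u == 1)) -> [/\ a = a', s = s' & b = b'].
Proof.
move=> v1 v2 e ha hs.
have ew : eqw (nf a ++ lets s ++ nf b) (nf a' ++ lets s' ++ nf b').
  by apply: eqw_trans (eqw_sym (nf_assemble v1)) _; rewrite e; apply: nf_assemble.
have ea : a = a' by rewrite -(eval_nf a) -(eval_nf a'); apply: eval_eqw; apply: eqw_prefix ew ha.
subst a'.
have hc u : cnt (nf a ++ lets s) u = cnt (nf a ++ lets s') u.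
  rewrite /cnt !count_cat; congr (_ + _)%N.
  rewrite /lets /lets_on; elim: (enum V) => //= w l ih.
  by rewrite hs; case: (s' w == 1) => //=; rewrite ih.
have es : s = s'.
  apply: lets_inj; rewrite !catA in ew.
  by apply: eqw_catI (eqw_prefix ew hc).
subst s'; split=> //; move: e; rewrite /assemble; exact: mulgI.
Qed.

(** * Lengths and the trilinear bound *)

Local Close Scope group_scope.
Local Open Scope ring_scope.

Variables (R : realType) (l : forall v, G v -> R).
Hypothesis hl : forall v, length_function (@l v).

(** The summand 1 per letter makes the length dominate the number of letters, in which the
    factorisation counts are polynomial. *)
Definition cost w : R := \sum_(y <- w) (1 + l (tagged y)).

Definition glen (g : GP) : R := cost (nf g).

Lemma cost_eqw w w' : eqw w w' -> cost w = cost w'.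
Proof. exact: big_tag_eqw. Qed.

Lemma size_eqw w w' : eqw w w' -> size w = size w'.
Proof. by move=> h; rewrite -!sum1_size; apply: big_tag_eqw. Qed.

Lemma cost_cat p q : cost (p ++ q) = cost p + cost q.
Proof. exact: big_cat. Qed.

Lemma cost_cons x w : cost (x :: w) = 1 + l (tagged x) + cost w.
Proof. exact: big_cons. Qed.

Lemma letter_ge0 x : 0 <= 1 + l (tagged x).
Proof. by rewrite addr_ge0 ?length_ge0. Qed.

Lemma cost_ge0 w : 0 <= cost w.
Proof. by apply: sumr_ge0 => x _; apply: letter_ge0. Qed.

Lemma size_cost w : (size w)%:R <= cost w.
Proof.
rewrite -sum1_size natr_sum; apply: ler_sum => x _.
by rewrite lerDl length_ge0.
Qed.

Lemma cost_cons1 v (c : G v) w : cost (cons1 c w) <= 1 + l c + cost w.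
Proof.
rewrite /cons1; case: eqP => _; last by rewrite cost_cons.
by rewrite lerDr (letter_ge0 (letter c)).
Qed.

Lemma cost_push v (a : G v) w : red w -> cost (push a w) <= 1 + l a + cost w.
Proof.
move=> rw; rewrite (cost_eqw (eqw_hdtl v rw)) /push.
apply: le_trans (cost_cons1 _ _) _; rewrite /cons1; case: eqP => [->|_].
  by rewrite mulg1.
rewrite cost_cons /= addrA lerD2r.
have := lengthM (hl v) a (hd v w); lra.
Qed.

(** Reducing a word never raises its cost; this is the source of the triangle inequality for
    [glen]. *)
Lemma cost_act s : cost (act s [::]) <= cost s.
Proof.
elim: s => [|x s ih] //; apply: le_trans (@cost_push _ (tagged x) _ (@red_act s [::] isT)) _.
by rewrite cost_cons lerD2l.
Qed.

Lemma glen_eval w : glen (eval w) <= cost w.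
Proof. by rewrite /glen (cost_eqw (nf_act w)) cost_act. Qed.

Lemma cost_invw w : cost (invw w) = cost w.
Proof.
rewrite /cost /invw (perm_big _ (permEl (perm_rev _))) big_map.
by apply: eq_bigr => x _; rewrite /= (lengthV (hl _)).
Qed.

Lemma glen_length : length_function glen.
Proof.
have hV g : glen g^-1%g <= glen g.
  by rewrite -{1}(eval_nf g) -eval_invw -[leRHS]cost_invw glen_eval.
split=> [|g|g h].
- apply/eqP; rewrite eq_le cost_ge0 andbT -eval_nil.
  by apply: le_trans (glen_eval _) _; rewrite /cost big_nil.
- by apply/eqP; rewrite eq_le hV /= -{1}(invgK g) hV.
- by rewrite -{1}(eval_nf g) -{1}(eval_nf h) -eval_cat -cost_cat glen_eval.
Qed.

Lemma glen_ge0 g : 0 <= glen g.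
Proof. exact: cost_ge0. Qed.

Lemma size_glen g : (size (nf g))%:R <= glen g.
Proof. exact: size_cost. Qed.

Lemma glen_assemble a s b : valid a s b ->
  glen (assemble a s b) = glen a + cost (lets s) + glen b.
Proof.
by move=> /nf_assemble /cost_eqw; rewrite /glen => ->; rewrite !cost_cat addrA.
Qed.

Lemma letter_cost_lets s v : l (s v) <= cost (lets s).
Proof.
have [->|sv] := eqVneq (s v) 1%g; first by rewrite (length1 (hl v)) cost_ge0.
have hv : letter (s v) \in lets s.
  by apply/mapP; exists v; rewrite // mem_filter sv mem_enum.
rewrite /cost (big_rem _ hv) /=.
have : 0 <= cost (rem (letter (s v)) (lets s)) by apply: cost_ge0.
by rewrite /cost; lra.
Qed.

(** * Counting factorisations *)

Local Notation m := #|V|.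

(* Summing the weight over all vectors of letter counts factors as a product
   over the vertices, whence the constant. *)
Lemma fibre_sum (x : GP) (T : seq (GP * dprod * GP)) : uniq T ->
  (forall t, t \in T -> valid t.1.1 t.1.2 t.2 /\ assemble t.1.1 t.1.2 t.2 = x) ->
  \sum_(t <- T) (1 + (size (nf t.1.1))%:R : R)^-1 ^+ (2 * m) <= 4 ^+ m.
Proof.
move=> uT hT; pose N := size (nf x).
(* By [assemble_inj], the letter counts of the prefix and the support of the middle part determine a
   factorisation of [x]. The counts are at most [N], so [inord] loses nothing. *)
pose key (t : GP * dprod * GP) : {ffun V -> 'I_N.+1} * {set V} :=
  ([ffun v => inord (cnt (nf t.1.1) v)], [set v | t.1.2 v == 1%g]).
pose f (k : {ffun V -> 'I_N.+1} * {set V}) : R :=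
  \prod_v (1 + (k.1 v)%:R : R)^-1 ^+ 2.
have f0 k : 0 <= f k.
  by apply: prodr_ge0 => v _; rewrite exprn_ge0 ?invr_ge0 ?addr_ge0.
have cN t v : t \in T -> (cnt (nf t.1.1) v < N.+1)%N.
  move=> /hT[vt et]; rewrite ltnS /N -et (size_eqw (nf_assemble vt)) size_cat.
  by apply: leq_trans (leq_addr _ _); apply: count_size.
have key_inj : {in T &, injective key}.
  move=> t t' tT t'T [/ffunP e1 /setP e2].
  have [vt et] := hT _ tT; have [vt' et'] := hT _ t'T.
  have [||ea es eb] := assemble_inj vt vt' (etrans et (esym et')).
  - move=> u; have := congr1 val (e1 u); rewrite !ffunE /=.
    by rewrite !inordK ?cN.
  - by move=> u; have := e2 u; rewrite !inE.
  by case: t t' ea es eb {tT t'T vt et vt' et' e1 e2} => [[a s] b] [[a' s'] b'] /= -> -> ->.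
(* The exponent 2m is shared out as a square for each vertex, whose count is at most the size. *)
have le1 t : t \in T -> (1 + (size (nf t.1.1))%:R : R)^-1 ^+ (2 * m) <= f (key t).
  move=> tT; rewrite exprM -prodr_const /f.
  apply: ler_prod => v _; rewrite exprn_ge0 ?invr_ge0 ?addr_ge0 //=.
  rewrite ffunE inordK ?cN // ler_sqr ?nnegrE ?invr_ge0 ?addr_ge0 //.
  by rewrite lef_pV2 ?posrE ?ltr_pwDl // lerD2l ler_nat count_size.
apply: (@le_trans _ _ (\sum_(t <- T) f (key t))).
  by rewrite big_seq [leRHS]big_seq; apply: ler_sum => t; apply: le1.
rewrite -(big_map key xpredT f).
apply: le_trans (sum_uniq_le _ f0) _; first by rewrite map_inj_in_uniq.
have -> : \sum_k f k = \sum_(n : {ffun V -> 'I_N.+1}) \sum_(A : {set V}) f (n, A).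
  by rewrite pair_bigA; apply: eq_bigr => -[].
(* The 2^m supports give one factor 2^m; the sums of inverse squares, each at most 2 by
   [sum_inv_sq], give the other. *)
rewrite /f /=; under eq_bigr do rewrite sumr_const.
rewrite sumrMnl -(bigA_distr_bigA (fun (v : V) (j : 'I_N.+1) => (1 + j%:R : R)^-1 ^+ 2)) /=.
rewrite prodr_const [X in _ *+ X](_ : _ = (2 ^ m)%N); last first.
  by rewrite -(cardsT V) -card_powerset powersetT cardsT; apply: eq_card.
rewrite -[leLHS]mulr_natr natrX.
have -> : 4 ^+ m = 2 ^+ m * 2 ^+ m :> R by rewrite -exprMn -natrM.
rewrite ler_wpM2r ?exprn_ge0 // lerXn2r ?nnegrE ?sum_inv_sq //.
by apply: sumr_ge0 => j _; rewrite exprn_ge0 ?invr_ge0 ?addr_ge0.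
Qed.

(** * The trilinear bound for the graph product *)

Variables (n : V -> nat) (C : V -> R).
Hypothesis C_ge0 : forall v, 0 <= C v.
Hypothesis G_bound : forall v, trilinear_bound (fun a b : G v => (a * b)%g)
  (fun a => (1 + l a) ^+ (2 * n v)) (C v).

Local Notation N := (\sum_v n v)%N.

Definition dweight (s : dprod) : R := \prod_v (1 + l (s v)) ^+ (2 * n v).

Lemma dweight_ge0 s : 0 <= dweight s.
Proof. by apply: prodr_ge0 => v _; rewrite exprn_ge0 ?addr_ge0 ?length_ge0. Qed.

(** Each coordinate of [s] has length at most that of the assembled element, and the exponents add
    up to 2N. *)
Lemma dweight_assemble a s b : valid a s b ->
  dweight s <= (1 + glen (assemble a s b)) ^+ (2 * N).
Proof.
move=> h; rewrite big_distrr /= -prodrXr; apply: ler_prod => v _.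
rewrite exprn_ge0 ?addr_ge0 ?length_ge0 //=.
apply: lerXn2r; rewrite ?nnegrE ?addr_ge0 ?glen_ge0 ?length_ge0 //.
rewrite lerD2l (glen_assemble h).
have := letter_cost_lets s v; have := glen_ge0 a; have := glen_ge0 b; lra.
Qed.

(* [damp] makes the sums over the factorisations of an element bounded.  It is put
   on the arguments [psi] and [chi] and compensated on [phi], where it only costs a
   power of the length. *)
Definition damp (a : GP) : R := (1 + (size (nf a))%:R)^-1 ^+ m.

Lemma damp_gt0 a : 0 < damp a.
Proof. by rewrite exprn_gt0 // invr_gt0 ltr_pwDl. Qed.

(** Grouping the triples by the element they assemble to leaves a damped count of each fibre; the
    square of [damp] has exactly the exponent of [fibre_sum]. *)
Lemma fibre_bound (sa sb : seq GP) (sd : seq dprod) (u : seq GP) (h : GP -> R) :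
  uniq sa -> uniq sb -> uniq sd -> uniq u -> (forall i, 0 <= h i) ->
  \sum_(a <- sa) \sum_(b <- sb) \sum_(s <- sd)
    (if valid a s b && (assemble a s b \in u)
     then damp a ^+ 2 * h (assemble a s b) else 0) <=
  4 ^+ m * \sum_(i <- u) h i.
Proof.
move=> ua ub ud uu h0.
pose T := [seq (i, b) | i <- [seq (a, s) | a <- sa, s <- sd], b <- sb].
have uT : uniq T.
  apply: allpairs_uniq => //; last by move=> [? ?] [? ?].
  by apply: allpairs_uniq => // -[? ?] [? ?].
pose asm (t : GP * dprod * GP) := assemble t.1.1 t.1.2 t.2.
pose val_ (t : GP * dprod * GP) := valid t.1.1 t.1.2 t.2.
have -> : \sum_(a <- sa) \sum_(b <- sb) \sum_(s <- sd)
    (if valid a s b && (assemble a s b \in u)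
     then damp a ^+ 2 * h (assemble a s b) else 0) =
    \sum_(t <- T) \sum_(i <- u | val_ t && (asm t == i)) damp t.1.1 ^+ 2 * h i.
  rewrite big_allpairs big_allpairs; apply: eq_bigr => a _.
  rewrite exchange_big; apply: eq_bigr => s _; apply: eq_bigr => b _.
  rewrite /val_ /asm /=; case: (valid a s b) => /=; last by rewrite big_pred0.
  case: (boolP (_ \in u)) => hu.
    rewrite (eq_bigl (fun i => i == assemble a s b)); last by move=> x; rewrite eq_sym.
    by rewrite -big_filter filter_pred1_uniq // big_seq1.
  rewrite big_seq_cond big_pred0 // => x.
  by apply/negP => /andP[xu /eqP ex]; rewrite ex xu in hu.
rewrite (exchange_big_dep xpredT) //= mulr_sumr; apply: ler_sum => x _.
rewrite -mulr_suml ler_wpM2r // -big_filter.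
under eq_bigr do rewrite /damp -exprM mulnC.
apply: (@fibre_sum x); first by rewrite filter_uniq.
by move=> y; rewrite mem_filter => /andP[/andP[vy /eqP ey] _].
Qed.

(** The factor [damp a ^+ 2] on the right is reserved for [fibre_bound]. Moved to the left, it
    leaves a 4m-th power of 1 plus the size of [a] and a 2m-th power of 1 plus that of [b^-1], both
    sizes being at most the total length; hence 6m. *)
Lemma glen_assemble_ge a s b : valid a s b ->
  ((damp a)^-1 * (damp b^-1%g)^-1) ^+ 2 <=
    damp a ^+ 2 * (1 + glen (assemble a s b)) ^+ (6 * m).
Proof.
move=> h; rewrite -ler_pdivrMl ?exprn_gt0 ?damp_gt0 //.
have -> : (damp a ^+ 2)^-1 * ((damp a)^-1 * (damp b^-1%g)^-1) ^+ 2 =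
   ((1 + (size (nf a))%:R) * (1 + (size (nf a))%:R) * (1 + (size (nf b^-1%g))%:R)) ^+ (2 * m).
  rewrite /damp -!exprVn !invrK mulnC exprM !exprMn -!exprM; ring.
have -> : (6 * m = 3 * (2 * m))%N by rewrite mulnA.
rewrite [leRHS]exprM; apply: lerXn2r; rewrite ?nnegrE ?mulr_ge0 ?exprn_ge0 ?addr_ge0 ?glen_ge0 //.
have ha := size_glen a; have hb := size_glen b^-1%g.
rewrite (lengthV glen_length) in hb.
have ea := glen_assemble h; have hs := cost_ge0 (lets s).
have ga := glen_ge0 a; have gb := glen_ge0 b.
rewrite !exprS expr0 mulr1 mulrA; apply: ler_pM.
- by rewrite mulr_ge0 ?addr_ge0.
- by rewrite addr_ge0.
- by apply: ler_pM; rewrite ?addr_ge0 // ea; lra.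
- by rewrite ea; lra.
Qed.

Lemma trilinear_graph_product :
  trilinear_bound (fun g h : GP => (g * h)%g)
    (fun g => (1 + glen g) ^+ (2 * (N + 3 * m)))
    (\prod_v C v * Num.sqrt (4 ^+ m) ^+ 3).
Proof.
move=> s t u phi psi chi us ut uu phi0 psi0 chi0 hu.
pose decomposes g h (x : GP * GP * GP * (dprod * dprod)) :=
  let: (a, c, b, (r, r')) := x in
  [/\ valid a r c, g = assemble a r c, valid c^-1%g r' b, h = assemble c^-1%g r' b &
    valid a (mulD r r') b /\ (g * h)%g = assemble a (mulD r r') b].
have decP g h : {i | decomposes g h i}.
  apply: cid; have [a [c [b [r [r' H]]]]] := product_assemble g h.
  by exists (a, c, b, (r, r')).
pose dec (p : GP * GP) := projT1 (decP p.1 p.2).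
pose P := [seq (g, h) | g <- s, h <- t].
have uP : uniq P by apply: allpairs_uniq => // -[? ?] [? ?].
pose L' := map dec P.
(* A decomposition determines [g] and [h], so the sum over pairs becomes a sum over distinct
   decompositions. *)
have uL : uniq L'.
  rewrite map_inj_uniq // => -[g h] [g' h']; rewrite /dec /=.
  case: (decP g h) => -[[[a c] b] [r r']] /= [_ -> _ -> _].
  by case: (decP g' h') => k /= + e; rewrite -e => -[_ -> _ -> _].
pose sa := undup (map (fun i => i.1.1.1) L').
pose sc := undup (map (fun i => i.1.1.2) L').
pose sb := undup (map (fun i => i.1.2) L').
pose sr := undup (map (fun i => i.2.1) L').
pose sr' := undup (map (fun i => i.2.2) L').
pose su := undup [seq mulD r r' | r <- sr, r' <- sr'].
(* The three damping factors multiply to 1. [damp c^-1] goes with [psi] because [c^-1] is the prefix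
   of h, and [damp a] with [chi] because [a] is the prefix of gh. *)
pose phiT a c r := if valid a r c && (assemble a r c \in s)
  then phi (assemble a r c) * ((damp a)^-1 * (damp c^-1%g)^-1) else 0.
pose psiT c b r := if valid c^-1%g r b && (assemble c^-1%g r b \in t)
  then damp c^-1%g * psi (assemble c^-1%g r b) else 0.
pose chiT a b r := if valid a r b && (assemble a r b \in u)
  then damp a * chi (assemble a r b) else 0.
have damp0 a : 0 <= damp a by apply/ltW/damp_gt0.
have phiT0 a c r : 0 <= phiT a c r.
  by rewrite /phiT; case: ifP => // _; rewrite !mulr_ge0 ?invr_ge0.
have psiT0 c b r : 0 <= psiT c b r by rewrite /psiT; case: ifP => // _; rewrite mulr_ge0.
have chiT0 a b r : 0 <= chiT a b r by rewrite /chiT; case: ifP => // _; rewrite mulr_ge0.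
pose F (x : GP * GP * GP * (dprod * dprod)) :=
  phiT x.1.1.1 x.1.1.2 x.2.1 * psiT x.1.1.2 x.1.2 x.2.2 *
  chiT x.1.1.1 x.1.2 (mulD x.2.1 x.2.2).
have -> : \sum_(i <- s) \sum_(j <- t) phi i * psi j * chi (i * j)%g = \sum_(i <- L') F i.
  rewrite big_map big_allpairs big_seq [RHS]big_seq; apply: eq_bigr => g gs.
  rewrite big_seq [RHS]big_seq; apply: eq_bigr => h ht.
  rewrite /F /dec /=; case: (decP g h) => -[[[a c] b] [r r']] /= [v1 e1 v2 e2 [v3 e3]].
  rewrite /phiT /psiT /chiT v1 v2 v3 -e1 -e2 -e3 gs ht hu //=.
  have := damp_gt0 a; have := damp_gt0 c^-1%g => /lt0r_neq0 d1 /lt0r_neq0 d2.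
  by field; rewrite d1 d2.
pose Q := [seq (i, e) | i <- [seq (j, b) | j <- [seq (a, c) | a <- sa, c <- sc], b <- sb],
  e <- [seq (r, r') | r <- sr, r' <- sr']].
have uQ : uniq Q.
  apply: allpairs_uniq => [||[? ?] [? ?] _ _ //].
    apply: allpairs_uniq => [||[? ?] [? ?] _ _ //]; last exact: undup_uniq.
    by apply: allpairs_uniq => [||[? ?] [? ?] _ _ //]; apply: undup_uniq.
  by apply: allpairs_uniq => [||[? ?] [? ?] _ _ //]; apply: undup_uniq.
have LQ : {subset L' <= Q}.
  move=> [[[a c] b] [r r']] xL; do !apply: allpairs_f; rewrite mem_undup.
  - by apply/mapP; exists (a, c, b, (r, r')).
  - by apply/mapP; exists (a, c, b, (r, r')).
  - by apply/mapP; exists (a, c, b, (r, r')).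
  - by apply/mapP; exists (a, c, b, (r, r')).
  - by apply/mapP; exists (a, c, b, (r, r')).
(* The terms are non-negative, so the sum may be enlarged to the whole box, where the five
   components vary independently. *)
apply: le_trans (ler_sum_sub uL uQ LQ _) _; first by move=> x; rewrite !mulr_ge0.
rewrite !big_allpairs /F /=.
pose A a c := Num.sqrt (\sum_(r <- sr) phiT a c r ^+ 2 * dweight r).
pose B c b := Num.sqrt (\sum_(r <- sr') psiT c b r ^+ 2).
pose D a b := Num.sqrt (\sum_(r <- su) chiT a b r ^+ 2).
have D_bound : trilinear_bound mulD dweight (\prod_v C v).
  apply: (@trilinear_dprod V G R (fun v (a : G v) => (1 + l a) ^+ (2 * n v)) C).
  - exact: C_ge0.
  - by move=> v a; rewrite exprn_ge0 ?addr_ge0 ?length_ge0.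
  - exact: G_bound.
apply: (@le_trans _ _ (\sum_(a <- sa) \sum_(c <- sc) \sum_(b <- sb)
   (\prod_v C v) * (A a c * B c b * D a b))).
  apply: ler_sum => a _; apply: ler_sum => c _; apply: ler_sum => b _.
  rewrite big_allpairs /=.
  apply: (D_bound sr sr' su (phiT a c) (psiT c b) (chiT a b)); rewrite ?undup_uniq //.
  by move=> k k' hk hk'; rewrite mem_undup allpairs_f.
have -> : \sum_(a <- sa) \sum_(c <- sc) \sum_(b <- sb)
    (\prod_v C v) * (A a c * B c b * D a b) = (\prod_v C v) *
    \sum_(a <- sa) \sum_(c <- sc) \sum_(b <- sb) A a c * B c b * D a b.
  rewrite mulr_sumr; apply: eq_bigr => a _; rewrite mulr_sumr.
  by apply: eq_bigr => c _; rewrite mulr_sumr.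
rewrite -[leRHS]mulrA ler_wpM2l ?prodr_ge0 //.
apply: le_trans (sum_triple_le _ _ _ _ _ _) _; first by move=> a b; apply: sqrtr_ge0.
have sqE (I : Type) (r : seq I) (f : I -> R) : (forall i, 0 <= f i) ->
    Num.sqrt (\sum_(i <- r) f i) ^+ 2 = \sum_(i <- r) f i.
  by move=> f0; rewrite sqr_sqrtr // sumr_ge0.
have h4 : 0 <= 4 ^+ m :> R by rewrite exprn_ge0.
have leA : \sum_(a <- sa) \sum_(c <- sc) A a c ^+ 2 <=
    4 ^+ m * \sum_(i <- s) phi i ^+ 2 * (1 + glen i) ^+ (2 * (N + 3 * m)).
  apply: le_trans (@fibre_bound sa sc sr s _ _ _ _ us _); rewrite ?undup_uniq //; last first.
    by move=> x; rewrite mulr_ge0 ?sqr_ge0 ?exprn_ge0 ?addr_ge0 ?glen_ge0.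
  apply: ler_sum => a _; apply: ler_sum => c _; rewrite sqE; last first.
    by move=> r; rewrite mulr_ge0 ?sqr_ge0 ?dweight_ge0.
  apply: ler_sum => r _; rewrite /phiT; case: ifP => [/andP[vr _]|_]; last first.
    by rewrite expr0n mul0r.
  have le_rest := ler_pM (sqr_ge0 _) (dweight_ge0 r) (glen_assemble_ge vr) (dweight_assemble vr).
  rewrite exprMn -[leLHS]mulrA.
  apply: le_trans (ler_wpM2l (sqr_ge0 _) le_rest) _.
  have -> : (2 * (N + 3 * m) = 6 * m + 2 * N)%N by rewrite mulnDr mulnA addnC.
  by rewrite exprD le_eqVlt; apply/orP; left; apply/eqP; ring.
have leB : \sum_(c <- sc) \sum_(b <- sb) B c b ^+ 2 <= 4 ^+ m * \sum_(i <- t) psi i ^+ 2.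
  (* The prefix is now [c^-1], so the outer sum is reindexed by inversion. *)
  apply: le_trans (@fibre_bound (map (fun g : GP => g^-1%g) sc) sb sr' t _ _ _ _ ut _);
    rewrite ?undup_uniq ?(map_inj_uniq invg_inj) ?undup_uniq //; last first.
    by move=> x; rewrite sqr_ge0.
  rewrite big_map; apply: ler_sum => c _; apply: ler_sum => b _; rewrite sqE; last first.
    by move=> r; rewrite sqr_ge0.
  apply: ler_sum => r _; rewrite /psiT; case: ifP => _; last by rewrite expr0n.
  by rewrite exprMn.
have leD : \sum_(a <- sa) \sum_(b <- sb) D a b ^+ 2 <= 4 ^+ m * \sum_(i <- u) chi i ^+ 2.
  apply: le_trans (@fibre_bound sa sb su u _ _ _ _ uu _);
    rewrite ?undup_uniq //; last by move=> x; rewrite sqr_ge0.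
  apply: ler_sum => a _; apply: ler_sum => b _; rewrite sqE; last first.
    by move=> r; rewrite sqr_ge0.
  apply: ler_sum => r _; rewrite /chiT; case: ifP => _; last by rewrite expr0n.
  by rewrite exprMn.
have sqle (j k : R) : j <= 4 ^+ m * k -> Num.sqrt j <= Num.sqrt (4 ^+ m) * Num.sqrt k.
  by move=> jk; rewrite -sqrtrM // ler_wsqrtr.
have kA := sqle _ _ leA; have kB := sqle _ _ leB; have kD := sqle _ _ leD.
have kAB := ler_pM (sqrtr_ge0 _) (sqrtr_ge0 _) kA kB.
apply: le_trans (ler_pM (mulr_ge0 (sqrtr_ge0 _) (sqrtr_ge0 _)) (sqrtr_ge0 _) kAB kD) _.
by rewrite le_eqVlt; apply/orP; left; apply/eqP; ring.
Qed.

End Words.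

Local Close Scope group_scope.
Local Open Scope ring_scope.

(** * Equivalence of property RD with the trilinear bound *)

Section RapidDecayTrilinear.
Variables (R : realType) (H : groupType).
Implicit Types (s t u : seq H) (l : H -> R).

Lemma fsum_seq (M : nmodType) s (F : H -> M) : uniq s ->
  (forall g, g \notin s -> F g = 0) ->
  \sum_(g \in [set: H]%classic) F g = \sum_(g <- s) F g.
Proof.
move=> us hF; rewrite (fsbigE s) //; last by move=> g _; apply: hF.
by apply: eq_bigl => g; rewrite in_setT.
Qed.

Lemma group_algebra_support (phi : H -> R[i]) : group_algebra phi ->
  exists2 s, uniq s & forall g, g \notin s -> phi g = 0.
Proof.
move=> /finite_seqP[s hs]; exists (undup s); first exact: undup_uniq.
move=> g gs; apply/eqP/negPn/negP => hg.
have : [set` s]%classic g by rewrite -hs.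
by move=> /= hgs; rewrite mem_undup hgs in gs.
Qed.

Lemma sum_convolution s t u (phi psi chi : H -> R) : uniq t -> uniq u ->
  (forall x y, x \in s -> y \in t -> (x * y)%g \in u) ->
  (forall g, g \notin t -> psi g = 0) ->
  \sum_(x <- s) \sum_(y <- t) phi x * psi y * chi (x * y)%g =
  \sum_(g <- u) (\sum_(x <- s) phi x * psi (x^-1 * g)%g) * chi g.
Proof.
move=> ut uu hu psi0; under [RHS]eq_bigr do rewrite mulr_suml.
rewrite [RHS]exchange_big big_seq [RHS]big_seq; apply: eq_bigr => x xs /=.
pose xt := [seq (x * y)%g | y <- t].
have uxt : uniq xt by rewrite map_inj_uniq //; apply: mulgI.
have xtu : {subset xt <= u} by move=> _ /mapP[y yt ->]; apply: hu.
transitivity (\sum_(g <- xt) phi x * psi (x^-1 * g)%g * chi g).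
  by rewrite big_map; apply: eq_bigr => y _; rewrite mulKg.
rewrite (sum_sub_uniq _ uxt uu xtu) big_mkcond; apply: eq_bigr => g _.
case: ifPn => // gxt; rewrite psi0 ?mulr0 ?mul0r //.
apply: contra gxt => h; apply/mapP; exists (x^-1 * g)%g => //.
by rewrite mulVKg.
Qed.

Lemma rapid_decay_trilinear : rapid_decay R H ->
  exists (C : R) (n : nat) l, [/\ 0 <= C, length_function l &
    trilinear_bound (fun x y : H => (x * y)%g) (fun g => (1 + l g) ^+ (2 * n)) C].
Proof.
(* Replacing [C] by its absolute value and [r] by a larger natural number only weakens the bound,
   since 1 + l is at least 1. *)
move=> [C [r [l [hl hC]]]]; exists `|C|, (Num.bound `|r|), l; split=> //.
have l0 := length_ge0 hl; set n := Num.bound _.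
have rn : r <= n%:R.
  by apply: le_trans (ler_norm _) _; apply/ltW/archi_boundP.
move=> s t u phi psi chi us ut uu phi0 psi0 chi0 hu.
have rhs0 : 0 <= `|C| * (Num.sqrt (\sum_(x <- s) phi x ^+ 2 * (1 + l x) ^+ (2 * n)) *
    Num.sqrt (\sum_(x <- t) psi x ^+ 2) * Num.sqrt (\sum_(x <- u) chi x ^+ 2)).
  by rewrite !mulr_ge0 ?sqrtr_ge0.
pose f g := if g \in s then phi g else 0; pose p g := if g \in t then psi g else 0.
pose k g := \sum_(x <- s) f x * p (x^-1 * g)%g.
have -> : \sum_(x <- s) \sum_(y <- t) phi x * psi y * chi (x * y)%g =
    \sum_(g <- u) k g * chi g.
  rewrite -(sum_convolution (s := s) (t := t) f chi ut uu hu); last first.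
    by move=> g gt; rewrite /p (negPf gt).
  rewrite big_seq [RHS]big_seq; apply: eq_bigr => x xs.
  rewrite big_seq [RHS]big_seq; apply: eq_bigr => y yt.
  by rewrite /f /p xs yt.
have nR (x : R) : Normc.normc x%:C%C ^+ 2 = x ^+ 2.
  by rewrite /= expr0n addr0 sqr_sqrtr ?sqr_ge0.
have n2 (r' : seq H) (q : H -> R) : uniq r' -> (forall g, g \notin r' -> q g = 0) ->
    norm2 (fun g => (q g)%:C%C) = Num.sqrt (\sum_(g <- r') q g ^+ 2).
  move=> ur hq; rewrite /norm2; congr Num.sqrt.
  rewrite (fsum_seq ur) => [|g /hq ->]; last by rewrite nR expr0n.
  by apply: eq_bigr => g _; rewrite nR.
have ga (r' : seq H) (q : H -> R) : (forall g, g \notin r' -> q g = 0) ->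
    group_algebra (fun g => (q g)%:C%C).
  move=> hq; apply: (sub_finite_set _ (finite_seq r')) => g /=.
  by apply: contra_neqT => /hq ->.
have fs g : g \notin s -> f g = 0 by move=> h; rewrite /f (negPf h).
have pt g : g \notin t -> p g = 0 by move=> h; rewrite /p (negPf h).
have ku g : g \notin u -> k g = 0.
  move=> gu; rewrite /k big_seq big1 // => x xs; rewrite pt ?mulr0 //.
  by apply: contra gu => h; rewrite -(mulVKg x g) hu.
have convE : convolution (fun g => (f g)%:C%C) (fun g => (p g)%:C%C) =
    (fun g => (k g)%:C%C).
  apply: funext => g; rewrite /convolution (fsum_seq us) => [|x /fs ->]; last first.
    by rewrite mul0r.
  by rewrite /k rmorph_sum; apply: eq_bigr => x _; rewrite rmorphM.
(* The supremum in property RD leaves out the zero function, so it is treated separately. *)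
have [p0|pn0] := pselect (forall g, p g = 0).
  by rewrite big1 // => g _; rewrite /k big1 ?mul0r // => x _; rewrite p0 mulr0.
have hne : (fun g => (p g)%:C%C) <> (fun=> 0 : R[i]).
  move=> e; apply: pn0 => g; have /(congr1 (@complex.Re R)) := congr1 (@^~ g) e.
  by [].
have Np : 0 < norm2 (fun g => (p g)%:C%C).
  rewrite (n2 t) // sqrtr_gt0 lt_neqAle sumr_ge0 ?andbT => [|g _]; last exact: sqr_ge0.
  apply/eqP => /esym/eqP; rewrite psumr_eq0 => [/allP h|g _]; last exact: sqr_ge0.
  apply: pn0 => g; case: (boolP (g \in t)) => [/h /=|/pt //].
  by rewrite sqrf_eq0 => /eqP.
have main : Num.sqrt (\sum_(g <- u) k g ^+ 2) <=
    `|C| * (Num.sqrt (\sum_(x <- s) phi x ^+ 2 * (1 + l x) ^+ (2 * n)) *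
            Num.sqrt (\sum_(x <- t) psi x ^+ 2)).
  have /ereal_supP/(_ _ (ex_intro2 _ _ _ (conj (ga t p pt) hne) erefl)) := hC _ (ga s f fs).
  rewrite lee_fin convE (n2 u k) // ler_pdivrMr // (n2 t p) // => /le_trans; apply.
  rewrite mulrA; have -> : \sum_(g <- t) p g ^+ 2 = \sum_(g <- t) psi g ^+ 2.
    by rewrite big_seq [RHS]big_seq; apply: eq_bigr => g gt; rewrite /p gt.
  apply: ler_wpM2r; first exact: sqrtr_ge0.
  apply: (@le_trans _ _ (`|C| * norm2w r l (fun g => (f g)%:C%C))).
    by apply: ler_wpM2r; [apply: sqrtr_ge0|apply: ler_norm].
  apply: ler_wpM2l => //; rewrite /norm2w; apply: ler_wsqrtr.
  rewrite (fsum_seq us) => [|x /fs ->]; last by rewrite nR expr0n mul0r.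
  rewrite big_seq [leRHS]big_seq; apply: ler_sum => x xs; rewrite nR /f xs.
  apply: ler_wpM2l; first exact: sqr_ge0.
  rewrite -powR_mulrn ?addr_ge0 //; apply: ler_powR; first by rewrite lerDl.
  by rewrite natrM; apply: ler_wpM2l.
apply: le_trans (cauchy_schwarz _ _ _) _.
by rewrite mulrA; apply: ler_wpM2r => //; apply: sqrtr_ge0.
Qed.

(** Passing to absolute values can only increase the convolution pointwise. Testing the resulting
    convolution [k] against itself bounds [X ^+ 2] by a multiple of [X], and a non-zero [X] is
    cancelled. *)
Lemma trilinear_rapid_decay C n l : 0 <= C -> length_function l ->
  trilinear_bound (fun x y : H => (x * y)%g) (fun g => (1 + l g) ^+ (2 * n)) C ->
  rapid_decay R H.
Proof.
move=> C0 hl hC; exists C, n%:R, l; split=> // phi phiA.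
have l0 := length_ge0 hl.
apply/ereal_supP => _ [psi [psiA psin0] <-]; rewrite lee_fin.
have [s us phis] := group_algebra_support phiA.
have [t ut psit] := group_algebra_support psiA.
pose u := undup [seq (x * y)%g | x <- s, y <- t].
have uu : uniq u by apply: undup_uniq.
have hu x y : x \in s -> y \in t -> (x * y)%g \in u.
  by move=> xs yt; rewrite mem_undup allpairs_f.
pose f g := Normc.normc (phi g); pose p g := Normc.normc (psi g).
have n0 (x : R[i]) : 0 <= Normc.normc x by case: x => a b; apply: sqrtr_ge0.
have pt g : g \notin t -> p g = 0 by move=> /psit h; rewrite /p h Normc.normc0.
pose k g := \sum_(x <- s) f x * p (x^-1 * g)%g.
have k0 g : 0 <= k g by apply: sumr_ge0 => x _; rewrite mulr_ge0 ?n0.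
have convE g : convolution phi psi g = \sum_(x <- s) phi x * psi (x^-1 * g)%g.
  by rewrite /convolution (fsum_seq us) // => x /phis ->; rewrite mul0r.
have conv_le g : Normc.normc (convolution phi psi g) <= k g.
  rewrite convE /k; elim: (s) => [|x r ih]; first by rewrite !big_nil Normc.normc0.
  rewrite !big_cons; apply: le_trans (le_normcD _ _) _.
  by rewrite Normc.normcM lerD2l.
have convu g : g \notin u -> convolution phi psi g = 0.
  move=> gu; rewrite convE big_seq big1 // => x xs; rewrite psit ?mulr0 //.
  by apply: contra gu => h; rewrite -(mulVKg x g) hu.
have Np : 0 < norm2 psi.
  rewrite sqrtr_gt0 (fsum_seq ut) => [|g /psit ->]; last by rewrite Normc.normc0 expr0n.
  rewrite lt_neqAle sumr_ge0 ?andbT => [|g _]; last exact: sqr_ge0.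
  apply/eqP => /esym/eqP; rewrite psumr_eq0 => [/allP h|g _]; last exact: sqr_ge0.
  apply: psin0; apply: funext => g; case: (boolP (g \in t)) => [/h /=|/psit //].
  by rewrite sqrf_eq0 => /eqP /Normc.eq0_normc.
rewrite ler_pdivrMr //.
have -> : norm2 psi = Num.sqrt (\sum_(g <- t) p g ^+ 2).
  by congr Num.sqrt; apply: fsum_seq => // g /psit ->; rewrite Normc.normc0 expr0n.
have -> : norm2w n%:R l phi = Num.sqrt (\sum_(g <- s) f g ^+ 2 * (1 + l g) ^+ (2 * n)).
  congr Num.sqrt; rewrite (fsum_seq us) => [|g /phis ->]; last first.
    by rewrite Normc.normc0 expr0n mul0r.
  by apply: eq_bigr => g _; rewrite -natrM powR_mulrn ?addr_ge0.
pose X := Num.sqrt (\sum_(g <- u) k g ^+ 2).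
have X2 : X ^+ 2 = \sum_(g <- u) k g ^+ 2.
  by rewrite sqr_sqrtr // sumr_ge0 // => g _; apply: sqr_ge0.
apply: (@le_trans _ _ X).
  apply: ler_wsqrtr; rewrite (fsum_seq uu) => [|g /convu ->]; last first.
    by rewrite Normc.normc0 expr0n.
  by apply: ler_sum => g _; apply: lerXn2r; rewrite ?nnegrE ?n0.
have := hC s t u f p k us ut uu (fun=> n0 _) (fun=> n0 _) k0 hu.
rewrite (sum_convolution (s := s) (t := t) f k ut uu hu pt) -/X.
under eq_bigr do rewrite -/(k _) -expr2.
rewrite -X2 mulrA mulrA expr2; have [->|Xn0] := eqVneq X 0.
  by move=> _; rewrite !mulr_ge0 ?sqrtr_ge0.
by rewrite ler_pM2r // lt_neqAle eq_sym Xn0 sqrtr_ge0.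
Qed.

End RapidDecayTrilinear.

Theorem theorem4p1 (R : realType) (V : finType) (E : rel V)
    (E_sym : symmetric E) (E_irr : irreflexive E) (G : V -> groupType)
    (G_RD : forall v : V, rapid_decay R (G v)) :
  rapid_decay R (graph_product E G).
Proof.
(* The data of each vertex group are chosen as families indexed by [v], the form in which
   [trilinear_graph_product] takes them. *)
have F v : {x : R * nat * (G v -> R) | [/\ 0 <= x.1.1, length_function x.2 &
    trilinear_bound (fun a b : G v => (a * b)%g)
      (fun g => (1 + x.2 g) ^+ (2 * x.1.2)) x.1.1]}.
  apply: cid; have [C [n [l H]]] := rapid_decay_trilinear (G_RD v).
  by exists (C, n, l).
pose C v := (projT1 (F v)).1.1; pose n v := (projT1 (F v)).1.2.
pose l v := (projT1 (F v)).2.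
have C0 v : 0 <= C v by rewrite /C; case: (F v) => /= x [].
have hl v : length_function (@l v) by rewrite /l; case: (F v) => /= x [].
have hb v : trilinear_bound (fun a b : G v => (a * b)%g)
    (fun a => (1 + l v a) ^+ (2 * n v)) (C v).
  by rewrite /l /n /C; case: (F v) => /= x [].
apply: trilinear_rapid_decay (glen_length E_sym E_irr hl)
  (trilinear_graph_product E_sym E_irr hl C0 hb).
by rewrite mulr_ge0 ?prodr_ge0 ?exprn_ge0 ?sqrtr_ge0.
Qed.
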